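(* Let $\{\mu_m\}$ be probability distributions on $\mathbb{R}$ and $\{\varphi_m\}$ the corresponding characteristic functions. Then $\{\mu_m\}$ is computable if and only if $\{\varphi_m\}$ is computable.
   Context: A probability distribution is a Borel probability measure $\mu$ on $\mathbb{R}$; $\mu(f)=\int f\,d\mu$; its characteristic function is $\varphi(t)=\int_{\mathbb{R}} e^{itx}\mu(dx)$. Computability of real functions is in the sense of Pour-El and Richards: $\{f_n\}$ is computable if (i) for every computable sequence of reals $\{x_j\}$, $\{f_n(x_j)\}$ is a computable double sequence, and (ii) there is a recursive $\alpha(n,L,k)$ with $|x-y|<2^{-\alpha(n,L,k)}$, $|x|,|y|\le L$ implying $|f_n(x)-f_n(y)|<2^{-k}$; a sequence of complex-valued functions is computable iff the sequences of real parts and of imaginary parts are computable. $\{f_n\}$ is computable with compact support if it is computable and there is a recursive $L(n)$ with $f_n(x)=0$ for $|x|\ge L(n)$. $\{\mu_m\}$ is computable if $\{\mu_m(f_n)\}$ is a computable double sequence of reals for every computable sequence of real functions $\{f_n\}$ with compact support. *)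

(* Defs.v *)
From HB Require Import structures.
From mathcomp Require Import all_boot all_order all_algebra.
From mathcomp Require Import all_classical all_reals all_analysis.
From mathcomp Require Import complex.

Set Implicit Arguments.
Unset Strict Implicit.
Unset Printing Implicit Defensive.

Import Order.TTheory GRing.Theory Num.Theory.
Import numFieldNormedType.Exports.

Local Open Scope ring_scope.
Local Open Scope complex_scope.

(* Total recursive functions: the least class containing the initial functions
   and closed under composition, primitive recursion and minimization of
   regular functions. The last two schemes are given by their defining
   equations, which determine [f] pointwise. *)
Inductive recursive : forall d : nat, (d.-tuple nat -> nat) -> Prop :=
| recursive_zero d : @recursive d (fun=> 0%N)
| recursive_succ : @recursive 1 (fun v => (thead v).+1)
| recursive_proj d (i : 'I_d) : @recursive d (fun v => tnth v i)
| recursive_comp d e (g : e.-tuple nat -> nat)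
    (h : 'I_e -> d.-tuple nat -> nat) :
    recursive g -> (forall i, recursive (h i)) ->
    @recursive d (fun v => g [tuple h i v | i < e])
| recursive_prim d (g : d.-tuple nat -> nat) (h : d.+2.-tuple nat -> nat)
    (f : d.+1.-tuple nat -> nat) :
    recursive g -> recursive h ->
    (forall v : d.-tuple nat, f [tuple of 0%N :: v] = g v) ->
    (forall (n : nat) (v : d.-tuple nat),
       f [tuple of n.+1 :: v] = h [tuple of n :: f [tuple of n :: v] :: v]) ->
    recursive f
| recursive_min d (g : d.+1.-tuple nat -> nat) (f : d.-tuple nat -> nat) :
    recursive g ->
    (forall v : d.-tuple nat, g [tuple of f v :: v] = 0%N) ->
    (forall (v : d.-tuple nat) (m : nat),
       (m < f v)%N -> g [tuple of m :: v] <> 0%N) ->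
    recursive f.

Section Indexing.
Variable T : Type.

Definition family1 (f : nat -> T) (v : 1.-tuple nat) : T :=
  f (nth 0%N v 0).

Definition family2 (f : nat -> nat -> T) (v : 2.-tuple nat) : T :=
  f (nth 0%N v 0) (nth 0%N v 1).

Definition family3 (f : nat -> nat -> nat -> T) (v : 3.-tuple nat) : T :=
  f (nth 0%N v 0) (nth 0%N v 1) (nth 0%N v 2).

End Indexing.

Definition computable_rats (d : nat) (r : d.-tuple nat -> rat) : Prop :=
  exists s a b : d.-tuple nat -> nat,
    [/\ recursive s, recursive a, recursive b &
      forall v, b v <> 0%N /\ r v = (-1) ^+ s v * (a v)%:R / (b v)%:R].

Section Computability.
Variable R : realType.

(* [d]-fold sequences of reals: a computable [d.+1]-fold sequence of rationals,
   whose first index is the approximation index, converges to [x] effectively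
   in all the indices. *)
Definition computable_reals (d : nat) (x : d.-tuple nat -> R) : Prop :=
  exists (r : d.+1.-tuple nat -> rat) (e : d.+1.-tuple nat -> nat),
    [/\ computable_rats r, recursive e &
      forall (v : d.-tuple nat) (N k : nat),
        (e [tuple of N :: v] <= k)%N ->
        `|ratr (r [tuple of k :: v]) - x v| <= 2^-1 ^+ N].

Definition computable_funs (f : nat -> R -> R) : Prop :=
  (forall x : nat -> R, computable_reals (family1 x) ->
     computable_reals (family2 (fun n j => f n (x j)))) /\
  (exists alpha : nat -> nat -> nat -> nat,
     recursive (family3 alpha) /\
     forall (n L k : nat) (x y : R),
       `|x - y| < 2^-1 ^+ alpha n L k -> `|x| <= L%:R -> `|y| <= L%:R ->
       `|f n x - f n y| < 2^-1 ^+ k).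

Definition computable_complex_funs (f : nat -> R -> R[i]) : Prop :=
  computable_funs (fun n x => complex.Re (f n x)) /\
  computable_funs (fun n x => complex.Im (f n x)).

Definition computable_compact_support_funs (f : nat -> R -> R) : Prop :=
  computable_funs f /\
  exists L : nat -> nat,
    recursive (family1 L) /\
    forall (n : nat) (x : R), (L n)%:R <= `|x| -> f n x = 0.

Definition computable_measures
    (mu : nat -> probability (measurableTypeR R) R) : Prop :=
  forall f : nat -> R -> R, computable_compact_support_funs f ->
    computable_reals (family2 (fun m n => Rintegral (mu m) setT (f n))).

Definition complex_exp (z : R[i]) : R[i] :=
  (expR (complex.Re z))%:C * (cos (complex.Im z) +i* sin (complex.Im z)).

Definition complex_integral (mu : probability (measurableTypeR R) R)
    (f : R -> R[i]) : R[i] :=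
  Rintegral mu setT (fun x => complex.Re (f x)) +i*
  Rintegral mu setT (fun x => complex.Im (f x)).

Definition characteristic_function (mu : probability (measurableTypeR R) R)
    (t : R) : R[i] :=
  complex_integral mu (fun x => complex_exp ('i * t%:C * x%:C)).

End Computability.

(* Main.v *)
Require Import Defs.
From mathcomp Require Import all_boot all_order all_algebra.
From mathcomp Require Import all_classical all_reals all_analysis.
From mathcomp Require Import complex.
From mathcomp Require Import zify ring lra.

(** If [mu] is computable, a search gives a recursive [N(m, K)] such that the
    tent function of radius [N] has [mu_m]-mass at least [1 - 2^-K]; hence
    [phi_m(t)] is an effective limit of integrals of compactly supported
    functions, and the same [N] gives a modulus of continuity.

    If [phi] is computable, the modulus of [Re phi_m] at [0] bounds the tails of
    [mu_m] effectively, by averaging [1 - cos (t x)] over equidistant [t] in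
    [0, d]. For [f] with compact support and [Q] large, [f x] is then close, up
    to a set of small mass, to [f (Q sin (x / Q))], and the latter is uniformly
    close to a Bernstein polynomial in [(1 + sin (x / Q)) / 2], whose integral is
    an explicit combination of values of [phi_m]. *)

(** Every bound has to be recursive in [m], in the index of the test function and in the precision
    at once, so each one is either an explicit formula or the result of a search decided on
    rationals. The functions that [phi] gives access to are trigonometric polynomials, which in
    general are not uniformly close on the whole line to a function of compact support. Replacing
    [x] by [Q sin (x / Q)] keeps the argument in [[-Q, Q]] for every [x], so the approximant obeys
    the same bound as [f] everywhere and the region far out costs only its small mass. Powers of
    [sin (x / Q)] have frequencies that are integer multiples of [1 / Q], so values of [phi] at
    rational points suffice and no Fourier inversion occurs. Bernstein polynomials are used because
    their error is explicit in the modulus of [f]. The averages over [t] are finite sums, so that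
    exchanging them with [mu_m] is linearity of the integral instead of Fubini. *)

Set Implicit Arguments.
Unset Strict Implicit.
Unset Printing Implicit Defensive.

Import Order.TTheory GRing.Theory Num.Theory.
Import numFieldNormedType.Exports.

Local Open Scope ring_scope.
Local Open Scope nat_scope.

(* Types built from [nat] by products, flattened to tuples: recursiveness can
   then be handled as in a cartesian category instead of coordinate by
   coordinate. *)
Class env (E : Type) := Env {
  arity : nat;
  flat : E -> arity.-tuple nat;
  flat_surj : forall t, exists e, flat e = t }.
Arguments arity E {_}.

Lemma flat_nat_surj (t : 1.-tuple nat) : exists n, [tuple n] = t.
Proof. by case: t => -[|n []] // s; exists n; apply: val_inj. Qed.

Instance env_nat : env nat := Env flat_nat_surj.

Lemma flat_prod_surj A B {EA : env A} {EB : env B} (t : (arity A + arity B).-tuple nat) :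
  exists p : A * B, [tuple of flat p.1 ++ flat p.2] = t.
Proof.
have [a Ha] := flat_surj [tuple tnth t (lshift (arity B) i) | i < arity A].
have [b Hb] := flat_surj [tuple tnth t (rshift (arity A) i) | i < arity B].
exists (a, b); apply: eq_from_tnth => i; rewrite Ha Hb /=.
by case: (split_ordP i) => j ->; rewrite ?tnth_lshift ?tnth_rshift tnth_mktuple.
Qed.

Instance env_prod A B {EA : env A} {EB : env B} : env (A * B) :=
  Env (@flat_prod_surj A B EA EB).

Lemma tnth_flat_fst {A B} {EA : env A} {EB : env B} (p : A * B) i :
  tnth (flat p) (lshift (arity B) i) = tnth (flat p.1) i.
Proof. exact: tnth_lshift. Qed.

Lemma tnth_flat_snd {A B} {EA : env A} {EB : env B} (p : A * B) i :
  tnth (flat p) (rshift (arity A) i) = tnth (flat p.2) i.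
Proof. exact: tnth_rshift. Qed.

Lemma flat_cons {E} {HE : env E} (n : nat) (e : E) :
  flat (n, e) = cons_tuple n (flat e) :> (1 + arity E).-tuple nat.
Proof. exact: val_inj. Qed.

Definition computes {E} {HE : env E} (f : (arity E).-tuple nat -> nat)
  (h : E -> nat) := recursive f /\ forall e, h e = f (flat e).

(** Coordinatewise, so that one notion covers maps into products and is stable under composition and
    pairing. *)
Definition rec {E E'} {HE : env E} {HE' : env E'} (h : E -> E') : Prop :=
  forall i, exists f, computes f (fun e => tnth (flat (h e)) i).

Lemma rec_natP {E} {HE : env E} (h : E -> nat) : rec h <-> exists f, computes f h.
Proof.
split=> [/(_ ord0) [f [rf fE]]|[f [rf fE]] i]; exists f; split=> // e.
by rewrite -fE; change 'I_1 in i; rewrite (ord1 i).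
Qed.

(** Surjectivity of [flat] makes a function of tuples determined by its values on flattened
    elements. *)
Lemma recursive_flat {E} {HE : env E} (f : (arity E).-tuple nat -> nat) :
  rec (fun e : E => f (flat e)) -> recursive f.
Proof.
move/rec_natP => [g [rg gE]]; suff -> : f = g by [].
by apply/funext => t; have [e <-] := flat_surj t.
Qed.

Lemma rec_ext {E E'} {HE : env E} {HE' : env E'} (g h : E -> E') :
  rec g -> g =1 h -> rec h.
Proof. by move=> + /funext <-. Qed.

Lemma rec_id {E} {HE : env E} : rec (fun e : E => e).
Proof. by move=> i; exists (fun t => tnth t i); split=> //; exact: recursive_proj. Qed.

Lemma rec_comp {E E' E''} {HE : env E} {HE' : env E'} {HE'' : env E''}
  (g : E' -> E'') (h : E -> E') : rec g -> rec h -> rec (fun e => g (h e)).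
Proof.
move=> rg rh i; have [g' [rg' gE]] := rg i.
have /choice [h' h'P] := rh.
exists (fun v => g' [tuple h' i v | i < arity E']); split.
  by apply: recursive_comp => // j; case: (h'P j).
move=> e; rewrite gE; congr g'; apply: eq_from_tnth => j.
by rewrite tnth_mktuple; case: (h'P j) => _ ->.
Qed.

Lemma rec_pair {E A B} {HE : env E} {HA : env A} {HB : env B}
  (f : E -> A) (g : E -> B) : rec f -> rec g -> rec (fun e => (f e, g e)).
Proof.
move=> rf rg i; case: (split_ordP i) => j ->.
  by have [k [rk kE]] := rf j; exists k; split=> // e; rewrite tnth_flat_fst; exact: kE.
by have [k [rk kE]] := rg j; exists k; split=> // e; rewrite tnth_flat_snd; exact: kE.
Qed.

Lemma rec_fst {E A B} {HE : env E} {HA : env A} {HB : env B} (f : E -> A * B) :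
  rec f -> rec (fun e => (f e).1).
Proof.
move=> rf i; have [k [rk kE]] := rf (lshift _ i).
by exists k; split=> // e; rewrite -kE; symmetry; exact: tnth_flat_fst.
Qed.

Lemma rec_snd {E A B} {HE : env E} {HA : env A} {HB : env B} (f : E -> A * B) :
  rec f -> rec (fun e => (f e).2).
Proof.
move=> rf i; have [k [rk kE]] := rf (rshift _ i).
by exists k; split=> // e; rewrite -kE; symmetry; exact: tnth_flat_snd.
Qed.

Lemma rec_succ {E} {HE : env E} (f : E -> nat) : rec f -> rec (fun e => (f e).+1).
Proof.
apply: (@rec_comp _ _ _ _ _ _ S); apply/rec_natP.
by eexists; split; first exact: recursive_succ.
Qed.

Lemma rec_cst {E} {HE : env E} (n : nat) : rec (fun _ : E => n).
Proof.
elim: n => [|n]; last exact: rec_succ.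
by apply/rec_natP; exists (fun=> 0); split=> //; exact: recursive_zero.
Qed.

Lemma rec_prim {E} {HE : env E} (g : E -> nat) (h : nat * (nat * E) -> nat)
  (f : nat * E -> nat) : rec g -> rec h ->
  (forall e, f (0, e) = g e) ->
  (forall n e, f (n.+1, e) = h (n, (f (n, e), e))) -> rec f.
Proof.
move=> /rec_natP [g' [rg gE]] /rec_natP [h' [rh hE]] f0 fS.
pose F n (v : (arity E).-tuple nat) :=
  nat_rec (fun=> nat) (g' v) (fun k r => h' [tuple of k :: r :: v]) n.
have bK n (v : (arity E).-tuple nat) : [tuple of behead [tuple of n :: v]] = v.
  exact: val_inj.
apply/rec_natP; exists (fun v => F (thead v) [tuple of behead v]); split.
  apply: (@recursive_prim _ g' h') => // [v|n v]; first by rewrite bK.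
  by rewrite !bK.
case=> n e; transitivity (F n (flat e)); last first.
  by rewrite flat_cons; congr F; apply: val_inj.
elim: n => [|n IH]; first by rewrite f0 gE.
by rewrite fS hE IH; congr h'; apply: val_inj.
Qed.

Lemma rec_min {E} {HE : env E} (p : nat * E -> nat) : rec p ->
  (forall e, exists n, p (n, e) = 0) ->
  exists2 f : E -> nat, rec f &
    forall e, p (f e, e) = 0 /\ forall m, m < f e -> p (m, e) <> 0.
Proof.
move=> /rec_natP [p' [rp pE]] pex.
have pmin e : exists n, p (n, e) = 0 /\ forall m, m < n -> p (m, e) <> 0.
  have [n pn] := pex e.
  have ex : exists n, p (n, e) == 0 by exists n; apply/eqP.
  exists (ex_minn ex); case: ex_minnP => k /eqP pk kmin; split=> // l lk /eqP /kmin.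
  by rewrite leqNgt lk.
have /choice [f fP] := pmin.
have /choice [s sK] := @flat_surj E HE.
exists f => //; apply/rec_natP; exists (f \o s).
have pflat n e : p (n, e) = p' (cons_tuple n (flat e)).
  by rewrite pE flat_cons.
have ps n v : p (n, s v) = p' (cons_tuple n v) by rewrite pflat sK.
have consE n (v : (arity E).-tuple nat) : [tuple of n :: v] = cons_tuple n v.
  exact: val_inj.
split.
  apply: (@recursive_min (arity E) p') => // v; last first.
    by move=> m /(fP (s v)).2; rewrite ps consE.
  by rewrite consE -ps; exact: (fP (s v)).1.
(* [flat] is not assumed injective, so [s (flat e)] may differ from [e]; the two define the same
   predicate of [n], hence have the same least zero. *)
move=> e; have pe n : p (n, s (flat e)) = p (n, e) by rewrite ps pflat.
have [H1 H2] := fP e; have [H3 H4] := fP (s (flat e)).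
case: (ltngtP (f e) (f (s (flat e)))) => // [/H4|/H2] [].
  by rewrite pe.
by rewrite -pe.
Qed.

(** * Arithmetic of recursive functions *)

(** The defining equations are hypotheses, so the scheme applies directly to existing library
    functions, with arbitrary recursive arguments substituted. *)
Lemma rec_prim2 {E E'} {HE : env E} {HE' : env E'} (g : E -> nat)
  (h : nat * (nat * E) -> nat) (f : nat -> E -> nat) (n : E' -> nat) (a : E' -> E) :
  rec g -> rec h -> (forall e, f 0 e = g e) ->
  (forall n e, f n.+1 e = h (n, (f n e, e))) ->
  rec n -> rec a -> rec (fun e => f (n e) (a e)).
Proof.
move=> rg rh f0 fS rn ra.
exact: (rec_comp (g := fun p => f p.1 p.2) (rec_prim rg rh f0 fS) (rec_pair rn ra)).
Qed.

Notation recb b := (rec (fun e => nat_of_bool (b e))).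

Lemma rec_add {E} {HE : env E} (f g : E -> nat) :
  rec f -> rec g -> rec (fun e => f e + g e).
Proof.
move=> rf rg; apply: (rec_prim2 (h := fun x => x.2.1.+1) _ _ _ _ rf rg) => //.
- exact: rec_id.
- by apply/rec_succ/rec_fst/rec_snd/rec_id.
Qed.

Lemma rec_mul {E} {HE : env E} (f g : E -> nat) :
  rec f -> rec g -> rec (fun e => f e * g e).
Proof.
move=> rf rg.
apply: (rec_prim2 (h := fun x => x.2.2 + x.2.1) _ _ _ _ rf rg) => //.
- exact: (rec_cst 0).
- by apply: rec_add; [apply/rec_snd|apply/rec_fst]; apply/rec_snd/rec_id.
Qed.

Lemma rec_pred {E} {HE : env E} (f : E -> nat) : rec f -> rec (fun e => (f e).-1).
Proof.
move=> rf; apply: (rec_prim2 (h := fun x => x.1) (f := fun n _ => n.-1) _ _ _ _ rf rf) => //.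
- exact: (rec_cst 0).
- exact/rec_fst/rec_id.
Qed.

Lemma rec_sub {E} {HE : env E} (f g : E -> nat) :
  rec f -> rec g -> rec (fun e => f e - g e).
Proof.
move=> rf rg.
apply: (rec_prim2 (h := fun x => x.2.1.-1) (f := fun n m => m - n) _ _ _ _ rg rf).
- exact: rec_id.
- by apply/rec_pred/rec_fst/rec_snd/rec_id.
- by move=> m; rewrite subn0.
- by move=> n m; rewrite subnS.
Qed.

Lemma rec_double {E} {HE : env E} (f : E -> nat) : rec f -> rec (fun e => (f e).*2).
Proof. by move=> rf; apply: (rec_ext (rec_add rf rf)) => e; rewrite addnn. Qed.

Lemma rec_exp {E} {HE : env E} (f g : E -> nat) :
  rec f -> rec g -> rec (fun e => f e ^ g e).
Proof.
move=> rf rg.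
apply: (rec_prim2 (h := fun x => x.2.2 * x.2.1) (f := fun n m => m ^ n) _ _ _ _ rg rf).
- exact: (rec_cst 1).
- by apply: rec_mul; [apply/rec_snd|apply/rec_fst]; apply/rec_snd/rec_id.
- by [].
- by move=> n m; rewrite expnS.
Qed.

Lemma rec_fact {E} {HE : env E} (f : E -> nat) : rec f -> rec (fun e => (f e)`!).
Proof.
move=> rf.
apply: (rec_prim2 (h := fun x => x.1.+1 * x.2.1) (f := fun n _ => n`!) _ _ _ _ rf rf).
- exact: (rec_cst 1).
- by apply: rec_mul; [apply/rec_succ|apply/rec_fst/rec_snd/rec_id]; apply/rec_fst/rec_id.
- by [].
- by move=> n e; rewrite factS.
Qed.

Lemma recb_leq {E} {HE : env E} (f g : E -> nat) :
  rec f -> rec g -> recb (fun e => f e <= g e).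
Proof.
move=> rf rg; apply: (rec_ext (rec_sub (rec_cst 1) (rec_sub rf rg))) => e.
by rewrite /leq; case: (f e - g e).
Qed.

Lemma recb_and {E} {HE : env E} (b c : E -> bool) :
  recb b -> recb c -> recb (fun e => b e && c e).
Proof. by move=> rb rc; apply: (rec_ext (rec_mul rb rc)) => e; rewrite mulnb. Qed.

Lemma recb_not {E} {HE : env E} (b : E -> bool) : recb b -> recb (fun e => ~~ b e).
Proof. by move=> rb; apply: (rec_ext (rec_sub (rec_cst 1) rb)) => e; case: (b e). Qed.

Lemma recb_eq {E} {HE : env E} (f g : E -> nat) :
  rec f -> rec g -> recb (fun e => f e == g e).
Proof.
move=> rf rg; apply: (rec_ext (recb_and (recb_leq rf rg) (recb_leq rg rf))) => e.
by rewrite eqn_leq.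
Qed.

Lemma rec_if {E} {HE : env E} (b : E -> bool) (f g : E -> nat) :
  recb b -> rec f -> rec g -> rec (fun e => if b e then f e else g e).
Proof.
move=> rb rf rg.
apply: (rec_ext (rec_add (rec_mul rb rf) (rec_mul (recb_not rb) rg))) => e.
by case: (b e); rewrite /= ?mul1n ?mul0n ?addn0.
Qed.

Lemma rec_odd {E} {HE : env E} (f : E -> nat) : rec f -> recb (fun e => odd (f e)).
Proof.
move=> rf.
apply: (rec_prim2 (h := fun x => 1 - x.2.1) (f := fun n _ => nat_of_bool (odd n))
  _ _ _ _ rf rf).
- exact: (rec_cst 0).
- by apply: rec_sub; [exact: rec_cst|apply/rec_fst/rec_snd/rec_id].
- by [].
- by move=> n _ /=; case: (odd n).
Qed.

Lemma rec_search {E} {HE : env E} (p : nat * E -> bool) : recb p ->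
  (forall e, exists n, p (n, e)) -> exists2 f : E -> nat, rec f &
    forall e, p (f e, e) /\ forall m, m < f e -> ~~ p (m, e).
Proof.
move=> /recb_not rp pex.
have [|f rf fP] := rec_min rp; first by move=> e; have [n pn] := pex e; exists n; rewrite /= pn.
exists f => // e; have /= [+ H] := fP e.
by case: (p _) => // _; split=> // m /H /=; case: (p _).
Qed.

Lemma rec_divn {E} {HE : env E} (f g : E -> nat) :
  rec f -> rec g -> rec (fun e => f e %/ g e).
Proof.
(* For a zero divisor the first disjunct stops the search at 0, in agreement with the convention
   [n %/ 0 = 0]. *)
move=> rf rg; pose p (x : nat * E) := ~~ (0 < g x.2) || (f x.2 < x.1.+1 * g x.2).
have rp : recb p.
  pose q (x : nat * E) := ~~ ((0 < g x.2) && ~~ (f x.2 < x.1.+1 * g x.2)).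
  have -> : p = q by apply/funext => x; rewrite /p /q negb_and negbK.
  have r2 := rec_snd (@rec_id (nat * E) _).
  apply: recb_not; apply: recb_and.
    by apply: recb_leq; [exact: rec_cst|exact: rec_comp].
  apply/recb_not/recb_leq; first exact/rec_succ/(rec_comp rf).
  apply: rec_mul; last exact: rec_comp.
  exact/rec_succ/rec_fst/rec_id.
have [|h rh hP] := rec_search rp.
  move=> e; exists (f e); rewrite /p /=; case: (posnP (g e)) => //= g0.
  by rewrite (leq_trans (ltnSn _)) // leq_pmulr.
apply: (rec_ext rh) => e; have [] := hP e; rewrite /p /=.
case: (posnP (g e)) => /= [-> _ hmin|g0 h1 hmin].
  by rewrite divn0; case: (h e) hmin => // n /(_ 0 isT).
apply/esym/eqP; rewrite eqn_leq -ltnS ltn_divLR // h1 leq_divRL //=.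
by case: (h e) hmin => // n /(_ n (ltnSn n)); rewrite -leqNgt.
Qed.

Lemma rec_bin {E} {HE : env E} (f g : E -> nat) :
  rec f -> rec g -> rec (fun e => 'C(f e, g e)).
Proof.
move=> rf rg.
apply: (rec_ext (rec_if (recb_leq rg rf)
  (rec_divn (rec_fact rf) (rec_mul (rec_fact rg) (rec_fact (rec_sub rf rg))))
  (rec_cst 0))) => e.
case: ifPn => [le|]; last by rewrite -ltnNge => /bin_small.
by rewrite -(bin_fact le) mulnK // muln_gt0 !fact_gt0.
Qed.

(** With the index reversed, passing from [n] to [n.+1] puts one new term in front and leaves the
    others unchanged. Splitting off the front term is valid for an arbitrary [op]. *)
Lemma rec_bigop {E} {HE : env E} (op : nat -> nat -> nat) (idx : nat)
  (f : nat * E -> nat) (n : E -> nat) :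
  rec (fun x => op x.1 x.2) -> rec f -> rec n ->
  rec (fun e => \big[op/idx]_(i < n e) f ((n e - i.+1), e)).
Proof.
move=> rop rf rn.
apply: (rec_prim2 (h := fun x => op (f (x.1, x.2.2)) x.2.1)
  (f := fun n e => \big[op/idx]_(i < n) f (n - i.+1, e)) _ _ _ _ rn rec_id).
- exact: (rec_cst idx).
- apply: (rec_comp rop (rec_pair (rec_comp rf _) _)).
    by apply: rec_pair; [exact/rec_fst/rec_id|exact/rec_snd/rec_snd/rec_id].
  exact/rec_fst/rec_snd/rec_id.
- by move=> e; rewrite big_ord0.
- by move=> k e; rewrite big_ord_recl /= subSS subn0.
Qed.

Lemma rec_sum {E} {HE : env E} (f : nat * E -> nat) (n : E -> nat) :
  rec f -> rec n -> rec (fun e => \sum_(i < n e) f (nat_of_ord i, e)).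
Proof.
move=> rf rn; have radd : rec (fun x => x.1 + x.2).
  by apply: rec_add; [exact/rec_fst/rec_id|exact/rec_snd/rec_id].
apply: (rec_ext (rec_bigop 0 radd rf rn)) => e.
by rewrite [RHS](reindex_inj rev_ord_inj).
Qed.

Lemma rec_prod {E} {HE : env E} (f : nat * E -> nat) (n : E -> nat) :
  rec f -> rec n -> rec (fun e => \prod_(i < n e) f (nat_of_ord i, e)).
Proof.
move=> rf rn; have rmul : rec (fun x => x.1 * x.2).
  by apply: rec_mul; [exact/rec_fst/rec_id|exact/rec_snd/rec_id].
apply: (rec_ext (rec_bigop 1 rmul rf rn)) => e.
by rewrite [RHS](reindex_inj rev_ord_inj).
Qed.

(** Follows the syntax of the function; a hypothesis [rec a] of the context acts as a further basic
    function. *)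
Ltac rec_step :=
  match goal with
  | H : ?P |- ?P => exact H
  | |- rec (fun e => e) => exact: rec_id
  | |- rec (@fst _ _) => apply: (rec_fst (f := fun e => e))
  | |- rec S => apply: (rec_succ (f := fun e => e))
  | |- rec (@snd _ _) => apply: (rec_snd (f := fun e => e))
  | |- rec (fun e => (@?f e, @?g e)) => apply: (rec_pair (f := f) (g := g))
  | |- rec (fun e => fst (@?f e)) => apply: (rec_fst (f := f))
  | |- rec (fun e => snd (@?f e)) => apply: (rec_snd (f := f))
  | H : rec ?a |- rec (fun e => ?a (@?h e)) => apply: (rec_comp (h := h) H)
  | H : recb ?a |- rec (fun e => nat_of_bool (?a (@?h e))) => apply: (rec_comp (h := h) H)
  | |- rec (fun e => S (@?f e)) => apply: (rec_succ (f := f))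
  | |- rec (fun e => double (@?f e)) => apply: (rec_double (f := f))
  | |- rec (fun e => predn (@?f e)) => apply: (rec_pred (f := f))
  | |- rec (fun e => addn (@?f e) (@?g e)) => apply: (rec_add (f := f) (g := g))
  | |- rec (fun e => muln (@?f e) (@?g e)) => apply: (rec_mul (f := f) (g := g))
  | |- rec (fun e => subn (@?f e) (@?g e)) => apply: (rec_sub (f := f) (g := g))
  | |- rec (fun e => expn (@?f e) (@?g e)) => apply: (rec_exp (f := f) (g := g))
  | |- rec (fun e => divn (@?f e) (@?g e)) => apply: (rec_divn (f := f) (g := g))
  | |- rec (fun e => binomial (@?f e) (@?g e)) => apply: (rec_bin (f := f) (g := g))
  | |- rec (fun e => factorial (@?f e)) => apply: (rec_fact (f := f))
  | |- rec (fun e => nat_of_bool (leq (@?f e) (@?g e))) =>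
      apply: (recb_leq (f := f) (g := g))
  | |- rec (fun e => nat_of_bool (eq_op (@?f e) (@?g e))) =>
      apply: (recb_eq (f := f) (g := g))
  | |- rec (fun e => nat_of_bool (andb (@?f e) (@?g e))) =>
      apply: (recb_and (b := f) (c := g))
  | |- rec (fun e => nat_of_bool (negb (@?f e))) => apply: (recb_not (b := f))
  | |- rec (fun e => nat_of_bool (odd (@?f e))) => apply: (rec_odd (f := f))
  | |- rec (fun e => if _ then _ else _) => apply: rec_if
  | |- rec (fun _ => ?c) => exact: (rec_cst c)
  end.
Ltac rec_tac := repeat (rec_step; cbv beta).

(** The definitions of computable functions and measures speak of sequences indexed by [nat]; a
    coding carries them to families over [E]. *)
Definition coded E {HE : env E} := exists (c : E -> nat) (d : nat -> E),
  [/\ rec c, rec d & cancel c d].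
Arguments coded E {HE}.

Lemma coded_nat : coded nat.
Proof. by exists id, id; split=> //; exact: rec_id. Qed.

(* The code of [(a, b)] is [(a + b) ^ 2 + a]; the square root recovers [a + b]. *)
Lemma coded_prod A B {HA : env A} {HB : env B} : coded A -> coded B -> coded (A * B).
Proof.
move=> [ca [da [rca rda caK]]] [cb [db [rcb rdb cbK]]].
have [||s rs sP] := @rec_search nat _ (fun x => x.2 < x.1.+1 * x.1.+1).
- rec_tac.
- by move=> n; exists n; rewrite /=; nia.
exists (fun p => (ca p.1 + cb p.2) * (ca p.1 + cb p.2) + ca p.1).
exists (fun n => (da (n - s n * s n), db (s n - (n - s n * s n)))); split.
- rec_tac.
- rec_tac.
case=> a b /=; set n := (X in s X); have [/= n1 n2] := sP n.
have sn : s n = ca a + cb b.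
  case: (ltngtP (s n) (ca a + cb b)) => // [lt|/n2]; last first.
    by rewrite /n; nia.
  by move: n1; rewrite {1}/n; nia.
by rewrite sn addKn addKn caK cbK.
Qed.

(** * Computable reals *)

Local Open Scope ring_scope.

Section ComputableReals.
Variable R : realType.
Implicit Types (N n k : nat).

Local Notation half := (2^-1 : R).

Lemma halfX_gt0 n : 0 < half ^+ n.
Proof. by rewrite exprn_gt0 // invr_gt0 ltr0n. Qed.

Lemma halfS n : half ^+ n = 2 * half ^+ n.+1.
Proof. by rewrite exprS mulrA mulfV ?mul1r // pnatr_eq0. Qed.

Lemma half_le1 n : half ^+ n <= 1.
Proof. by rewrite exprn_ile1 ?invr_ge0 ?ler0n // invf_le1 ?ltr0n // ler1n. Qed.

Lemma natr_half_le1 n : n%:R * half ^+ n <= 1.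
Proof.
by rewrite exprVn ler_pdivrMr ?exprn_gt0 ?ltr0n // mul1r -natrX ler_nat ltnW // ltn_expl.
Qed.

(** Asking for [k] extra bits absorbs a factor [k], because [k <= 2 ^ k]. The error budgets for
    products, sums, series and integrals rest on this. *)
Lemma natr_half_le k n : k%:R * half ^+ (n + k) <= half ^+ n.
Proof.
by rewrite exprD mulrCA -[leRHS]mulr1 ler_wpM2l ?natr_half_le1.
Qed.

Lemma half_decr m n : (m <= n)%N -> half ^+ n <= half ^+ m.
Proof.
by move=> mn; rewrite ler_wiXn2l ?invr_ge0 ?ler0n // invf_le1 ?ltr0n // ler1n.
Qed.

(** A difference of naturals as numerator makes addition and multiplication polynomial in the data,
    without case distinctions on signs; the values lie in [R] to avoid casts from [rat]. *)
Definition recq {E} {HE : env E} (q : E -> R) := exists a b d : E -> nat,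
  [/\ rec a, rec b, rec d &
    forall e, (0 < d e)%N /\ q e = ((a e)%:R - (b e)%:R) / (d e)%:R].

Lemma recq_comp {E E'} {HE : env E} {HE' : env E'} (q : E' -> R) (h : E -> E') :
  recq q -> rec h -> recq (fun e => q (h e)).
Proof.
move=> [a [b [d [ra rb rd qE]]]] rh.
exists (fun e => a (h e)), (fun e => b (h e)), (fun e => d (h e)).
by split; [rec_tac|rec_tac|rec_tac|].
Qed.

Lemma recq_nat {E} {HE : env E} (f : E -> nat) : rec f -> recq (fun e => (f e)%:R).
Proof.
move=> rf; exists f, (fun=> 0%N), (fun=> 1%N); split; [by []|rec_tac|rec_tac|].
by move=> e; rewrite subr0 divr1.
Qed.

Lemma recq_invn {E} {HE : env E} (f : E -> nat) : rec f -> (forall e, 0 < f e)%N ->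
  recq (fun e => (f e)%:R^-1).
Proof.
move=> rf f0; exists (fun=> 1%N), (fun=> 0%N), f; split; [rec_tac|rec_tac|by []|].
by move=> e; rewrite subr0 div1r.
Qed.

Lemma recq_opp {E} {HE : env E} (q : E -> R) : recq q -> recq (fun e => - q e).
Proof.
move=> [a [b [d [ra rb rd qE]]]]; exists b, a, d; split=> // e.
by have [d0 ->] := qE e; rewrite -mulNr opprB.
Qed.

Lemma recq_add {E} {HE : env E} (q r : E -> R) :
  recq q -> recq r -> recq (fun e => q e + r e).
Proof.
move=> [a [b [d [ra rb rd qE]]]] [a' [b' [d' [ra' rb' rd' rE]]]].
exists (fun e => a e * d' e + a' e * d e)%N, (fun e => b e * d' e + b' e * d e)%N,
  (fun e => d e * d' e)%N; split; [rec_tac|rec_tac|rec_tac|].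
move=> e; have [d0 ->] := qE e; have [d'0 ->] := rE e; split; first by rewrite muln_gt0 d0.
rewrite !natrD !natrM; field.
by rewrite !pnatr_eq0 -!lt0n d0 d'0.
Qed.

Lemma recq_sub {E} {HE : env E} (q r : E -> R) :
  recq q -> recq r -> recq (fun e => q e - r e).
Proof. by move=> rq rr; apply: recq_add => //; exact: recq_opp. Qed.

Lemma recq_mul {E} {HE : env E} (q r : E -> R) :
  recq q -> recq r -> recq (fun e => q e * r e).
Proof.
move=> [a [b [d [ra rb rd qE]]]] [a' [b' [d' [ra' rb' rd' rE]]]].
exists (fun e => a e * a' e + b e * b' e)%N, (fun e => a e * b' e + b e * a' e)%N,
  (fun e => d e * d' e)%N; split; [rec_tac|rec_tac|rec_tac|].
move=> e; have [d0 ->] := qE e; have [d'0 ->] := rE e; split; first by rewrite muln_gt0 d0.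
rewrite !natrD !natrM; field.
by rewrite !pnatr_eq0 -!lt0n d0 d'0.
Qed.

Lemma natr_sub_split (a b : nat) : a%:R - b%:R = (a - b)%N%:R - (b - a)%N%:R :> R.
Proof.
case: (leqP a b) => ab.
  by rewrite (eqP ab) natrB // sub0r opprB.
by rewrite natrB 1?ltnW // (eqP (ltnW ab)) subr0.
Qed.

Lemma recq_abs {E} {HE : env E} (q : E -> R) : recq q -> recq (fun e => `|q e|).
Proof.
move=> [a [b [d [ra rb rd qE]]]].
exists (fun e => (a e - b e) + (b e - a e))%N, (fun=> 0%N), d; split; [rec_tac|rec_tac|by []|].
move=> e; have [d0 ->] := qE e; split=> //.
rewrite normrM normfV normr_nat subr0; congr (_ / _).
case: (leqP (a e) (b e)) => ab.
  by rewrite (eqP ab) add0n natrB // ler0_norm ?opprB // subr_le0 ler_nat.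
rewrite (eqP (ltnW ab)) addn0 natrB 1?ltnW //.
by rewrite ger0_norm // subr_ge0 ler_nat ltnW.
Qed.

Lemma recq_pow {E} {HE : env E} (q : E -> R) (n : E -> nat) :
  recq q -> rec n -> recq (fun e => q e ^+ n e).
Proof.
move=> [a [b [d [ra rb rd qE]]]] rn.
(* The power of a negative numerator belongs to the subtracted part exactly when the exponent is
   odd. *)
exists (fun e => if a e < b e then if odd (n e) then 0 else (b e - a e) ^ n e
                 else (a e - b e) ^ n e)%N,
  (fun e => if a e < b e then if odd (n e) then (b e - a e) ^ n e else 0 else 0)%N,
  (fun e => d e ^ n e)%N; split; [rec_tac|rec_tac|rec_tac|].
move=> e; have [d0 ->] := qE e; split; first by rewrite expn_gt0 d0.
rewrite expr_div_n natrX; congr (_ / _); rewrite natr_sub_split.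
case: ltnP => ab; last by rewrite (eqP ab) !subr0 natrX.
rewrite (eqP (ltnW ab)) sub0r exprNn -signr_odd.
by case: (odd _); rewrite ?natrX ?expr1 ?expr0 ?mulN1r ?sub0r ?mul1r ?subr0.
Qed.

Lemma recq_sign {E} {HE : env E} (n : E -> nat) : rec n -> recq (fun e => (-1) ^+ n e).
Proof.
by move=> rn; apply: recq_pow => //; exact: (recq_opp (recq_nat (rec_cst 1))).
Qed.

Lemma recq_sum {E} {HE : env E} (q : nat * E -> R) (n : E -> nat) :
  recq q -> rec n -> recq (fun e => \sum_(i < n e) q (nat_of_ord i, e)).
Proof.
move=> [a [b [d [ra rb rd qE]]]] rn.
(* The common denominator of all the terms; [D e %/ d (i, e)] is the cofactor of the term [i]. *)
pose D e := (\prod_(i < n e) d (nat_of_ord i, e))%N.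
have rD : rec D by exact: rec_prod.
pose A (a : nat * E -> nat) e :=
  (\sum_(i < n e) a (nat_of_ord i, e) * (D e %/ d (nat_of_ord i, e)))%N.
have rA a' : rec a' -> rec (A a').
  by move=> ra'; apply: (rec_sum (f := fun x => a' x * (D x.2 %/ d x))%N) => //; rec_tac.
have D0 e : (0 < D e)%N by apply: prodn_gt0 => i; have [] := qE (nat_of_ord i, e).
exists (A a), (A b), D; split; [exact: rA|exact: rA|by []|] => e; split=> //.
rewrite !natr_sum -sumrB big_distrl /=; apply: eq_bigr => i _.
have [d0 ->] := qE (nat_of_ord i, e).
have dD : (d (nat_of_ord i, e) %| D e)%N by rewrite /D (bigD1 i) //= dvdn_mulr.
rewrite !natrM natr_div //; last by rewrite unitfE pnatr_eq0 -lt0n.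
field; rewrite !pnatr_eq0 -!lt0n d0 D0 //.
Qed.

Lemma recb_gt0 {E} {HE : env E} (q : E -> R) : recq q -> recb (fun e => 0 < q e).
Proof.
move=> [a [b [d [ra rb rd qE]]]].
have rab : recb (fun e => (b e < a e)%N) by rec_tac.
apply: (rec_ext rab) => e; have [d0 ->] := qE e.
by rewrite pmulr_lgt0 ?invr_gt0 ?ltr0n // subr_gt0 ltr_nat.
Qed.

(** The stage is the precision: the modulus of convergence has been composed into the rational
    approximations. *)
Definition creal {E} {HE : env E} (x : E -> R) := exists q : nat * E -> R,
  recq q /\ forall N e, `|q (N, e) - x e| <= half ^+ N.

Lemma creal_ext {E} {HE : env E} (x y : E -> R) : creal x -> x =1 y -> creal y.
Proof. by move=> + /funext <-. Qed.

Lemma creal_recq {E} {HE : env E} (q : E -> R) : recq q -> creal q.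
Proof.
move=> rq; exists (fun p => q p.2); split; first by apply: recq_comp rq _; rec_tac.
by move=> N e; rewrite subrr normr0; exact/ltW/halfX_gt0.
Qed.

Lemma creal_comp {E E'} {HE : env E} {HE' : env E'} (x : E' -> R) (h : E -> E') :
  creal x -> rec h -> creal (fun e => x (h e)).
Proof.
move=> [q [rq qx]] rh; exists (fun p => q (p.1, h p.2)); split=> //.
by apply: recq_comp rq _; rec_tac.
Qed.

Lemma creal_lim {E} {HE : env E} (x : nat * E -> R) (y : E -> R) : creal x ->
  (forall N e, `|x (N, e) - y e| <= half ^+ N) -> creal y.
Proof.
move=> [q [rq qx]] xy; exists (fun p => q (p.1.+1, (p.1.+1, p.2))); split.
  by apply: recq_comp rq _; rec_tac.
move=> N e; rewrite halfS mulr_natl mulr2n.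
by rewrite (le_trans (ler_distD (x (N.+1, e)) _ _)) // lerD.
Qed.

Lemma creal_bound {E} {HE : env E} (x : E -> R) : creal x ->
  exists2 b : E -> nat, rec b & forall e, `|x e| <= (b e)%:R.
Proof.
move=> [q [[a [b [d [ra rb rd qE]]]] qx]].
(* The approximation at stage 0 is within 1 of [x], and dividing by [d >= 1] does not increase [a]
   and [b]. *)
exists (fun e => a (0%N, e) + b (0%N, e) + 1)%N; first by rec_tac.
move=> e; have := qx 0%N e; rewrite expr0; have [d0 ->] := qE (0%N, e) => H.
have -> : x e = (a (0%N, e))%:R / (d (0%N, e))%:R - (b (0%N, e))%:R / (d (0%N, e))%:R -
  (((a (0%N, e))%:R - (b (0%N, e))%:R) / (d (0%N, e))%:R - x e) by ring.
rewrite (le_trans (ler_normB _ _)) // natrD lerD // (le_trans (ler_normB _ _)) // natrD.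
have le c : `|c%:R / (d (0%N, e))%:R| <= c%:R :> R.
  rewrite normrM normfV !normr_nat ler_pdivrMr ?ltr0n //.
  by rewrite -natrM ler_nat leq_pmulr.
by rewrite lerD.
Qed.

Lemma creal_add {E} {HE : env E} (x y : E -> R) :
  creal x -> creal y -> creal (fun e => x e + y e).
Proof.
move=> [q [rq qx]] [r [rr ry]].
exists (fun p => q (p.1.+1, p.2) + r (p.1.+1, p.2)); split.
  by apply: recq_add; [apply: recq_comp rq _|apply: recq_comp rr _]; rec_tac.
move=> N e; rewrite halfS mulr_natl mulr2n opprD addrACA.
by rewrite (le_trans (ler_normD _ _)) // lerD.
Qed.

Lemma creal_opp {E} {HE : env E} (x : E -> R) : creal x -> creal (fun e => - x e).
Proof.
move=> [q [rq qx]]; exists (fun p => - q p); split; first exact: recq_opp.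
by move=> N e; rewrite -opprD normrN.
Qed.

Lemma creal_sub {E} {HE : env E} (x y : E -> R) :
  creal x -> creal y -> creal (fun e => x e - y e).
Proof. by move=> cx cy; apply: creal_add => //; exact: creal_opp. Qed.

Lemma creal_abs {E} {HE : env E} (x : E -> R) : creal x -> creal (fun e => `|x e|).
Proof.
move=> [q [rq qx]]; exists (fun p => `|q p|); split; first exact: recq_abs.
by move=> N e; rewrite (le_trans (ler_dist_dist _ _)).
Qed.

Lemma creal_mul {E} {HE : env E} (x y : E -> R) :
  creal x -> creal y -> creal (fun e => x e * y e).
Proof.
move=> cx cy; have [a ra xa] := creal_bound cx; have [b rb yb] := creal_bound cy.
move: cx cy => [q [rq qx]] [r [rr ry]].
(* The identity below bounds the error by [(a + 1 + b) * 2^-M]: [a] and [b] bound [x] and [y], and 1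
   bounds the deviation of [q] from [x]. *)
pose M (p : nat * E) := (p.1 + (a p.2 + 1 + b p.2))%N.
have rM : rec M by rewrite /M; rec_tac.
exists (fun p => q (M p, p.2) * r (M p, p.2)); split.
  by apply: recq_mul; [apply: recq_comp rq _|apply: recq_comp rr _]; rec_tac.
move=> N e; cbn [fst snd]; set m := M (N, e).
have -> : q (m, e) * r (m, e) - x e * y e =
  (x e + (q (m, e) - x e)) * (r (m, e) - y e) + y e * (q (m, e) - x e) by ring.
apply: le_trans (natr_half_le (a e + 1 + b e) N); rewrite -[(N + _)%N]/m.
rewrite (le_trans (ler_normD _ _)) // natrD [leRHS]mulrDl !normrM lerD ?ler_pM //.
rewrite natrD (le_trans (ler_normD _ _)) // lerD //.
by rewrite (le_trans (qx _ _)) // half_le1.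
Qed.

Lemma creal_sum {E} {HE : env E} (x : nat * E -> R) (n : E -> nat) :
  creal x -> rec n -> creal (fun e => \sum_(i < n e) x (nat_of_ord i, e)).
Proof.
move=> [q [rq qx]] rn.
exists (fun p => \sum_(i < n p.2) q ((p.1 + n p.2)%N, (nat_of_ord i, p.2))); split.
  apply: (recq_sum (q := fun u => q ((u.2.1 + n u.2.2)%N, (u.1, u.2.2)))).
    by apply: recq_comp rq _; rec_tac.
  by rec_tac.
move=> N e; rewrite -sumrB /=; apply: le_trans (ler_norm_sum _ _ _) _.
apply: le_trans (natr_half_le (n e) N).
rewrite (le_trans (ler_sum _ (fun i _ => qx _ _))) // sumr_const card_ord.
by rewrite mulr_natl.
Qed.

End ComputableReals.

(** * Sine and cosine *)

Local Open Scope classical_set_scope.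
Local Open Scope ring_scope.

Section Trigonometry.
Variable R : realType.

Local Notation half := (2^-1 : R).

(** Free of the order of [x] and [y]. The location of [c] is kept because [sin_sub_id_le] estimates
    the derivative by the distance of [c] from 0. *)
Lemma mean_value (f df : R -> R) (x y : R) :
  (forall z : R, is_derive z 1 f (df z)) ->
  exists2 c, `|c - y| <= `|x - y| & f x - f y = df c * (x - y).
Proof.
move=> fd; have cf a b : {within `[a, b], continuous f}.
  apply: continuous_subspaceT => z; apply/differentiable_continuous.
  by apply/derivable1_diffP; exact: (@ex_derive _ _ _ _ _ _ _ (fd z)).
have key a b : a <= b -> exists2 c, a <= c <= b & f b - f a = df c * (b - a).
  move=> ab; have [c + E] := MVT_segment ab (fun z _ => fd z) (cf a b).
  by rewrite in_itv /= => cab; exists c.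
case: (leP y x) => xy.
  have [c /andP[yc cx] E] := key _ _ xy; exists c => //.
  by rewrite !ger0_norm ?subr_ge0 // lerB.
have [c /andP[yc cx] E] := key _ _ (ltW xy); exists c.
  by rewrite !ler0_norm ?subr_le0 ?(ltW xy) // !opprB lerB.
by rewrite -[LHS]opprB E -mulrN opprB.
Qed.

Lemma cos_lipschitz (x y : R) : `|cos x - cos y| <= `|x - y|.
Proof.
have [c _ ->] := mean_value x y (@is_derive_cos R).
by rewrite normrM normrN ler_piMl // sin_max.
Qed.

Lemma sin_lipschitz (x y : R) : `|sin x - sin y| <= `|x - y|.
Proof.
have [c _ ->] := mean_value x y (@is_derive_sin R).
by rewrite normrM ler_piMl // cos_max.
Qed.

(** The derivative [cos u - 1] of [sin u - u] is at most [|u|] in absolute value. The true order is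
    cubic, but a quadratic bound suffices to make [Q sin (x / Q)] tend to [x]. *)
Lemma sin_sub_id_le (x : R) : `|sin x - x| <= x ^+ 2.
Proof.
have d (z : R) : is_derive z 1 (fun u : R => sin u - u) (cos z - 1).
  by apply: is_deriveB.
have [c] := mean_value x 0 d; rewrite !subr0 sin0 subr0 => cx ->.
rewrite normrM -real_normK ?num_real // expr2 ler_wpM2r //.
by rewrite (le_trans _ cx) // -cos0 (le_trans (cos_lipschitz _ _)) // subr0.
Qed.

Lemma series_tail (u : nat -> R) (l K : R) (n : nat) :
  (forall k, `|u k| <= K * half ^+ k) -> series u @ \oo --> l ->
  `|series u n - l| <= 2 * K * half ^+ n.
Proof.
move=> uK cu.
have K0 : 0 <= K by have := uK 0%N; rewrite expr0 mulr1; exact: le_trans.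
(* The geometric sum in closed form, so that the induction on [j] telescopes. *)
have tail j : `|series u (n + j)%N - series u n| <=
    2 * K * (half ^+ n - half ^+ (n + j)%N).
  elim: j => [|j IH]; first by rewrite addn0 !subrr normr0 mulr0.
  have -> : series u (n + j.+1)%N = series u (n + j)%N + u (n + j)%N.
    by rewrite addnS seriesSr.
  rewrite addrAC (le_trans (ler_normD _ _)) // (le_trans (lerD IH (uK _))) //.
  by rewrite addnS (halfS R (n + j)) le_eqVlt; apply/orP; left; apply/eqP; ring.
apply/ler_addgt0Pr => e e0.
have /cvgrPdist_le /(_ e e0) [m _ hm] := cu.
have := hm (n + m)%N (leq_addl _ _) => /= h.
have -> : series u n - l = (series u (n + m)%N - l) - (series u (n + m)%N - series u n).
  by ring.
rewrite (le_trans (ler_normB _ _)) // addrC lerD //; last by rewrite distrC.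
by rewrite (le_trans (tail m)) // ler_wpM2l ?mulr_ge0 // lerBlDr lerDl ltW ?halfX_gt0.
Qed.

(** Beyond the first [d] factors, each factor [d] is dominated by the matching factor of the
    factorial. *)
Lemma expn_le_fact (d m : nat) : (d ^ m <= d ^ d * m`!)%N.
Proof.
elim: m => [|m IH]; first by rewrite muln1 expn_gt0; case: d.
case: (ltnP m d) => md.
  rewrite (leq_trans (leq_pexp2l _ md)) ?leq_pmulr ?fact_gt0 //.
  exact: leq_ltn_trans md.
by rewrite expnS factS mulnCA leq_mul // ltnW.
Qed.

(** [expn_le_fact] with [d = 2 * c]: the spare factor [2 ^ m] turns factorial decay into geometric
    decay with a recursive constant. *)
Lemma expr_fact_le (x : R) (c m : nat) : `|x| <= c%:R ->
  `|x ^+ m / m`!%:R| <= ((2 * c) ^ (2 * c))%:R * half ^+ m.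
Proof.
move=> xc; rewrite normrM normfV normrX normr_nat ler_pdivrMr ?ltr0n ?fact_gt0 //.
rewrite mulrAC -natrM exprVn ler_pdivlMr ?exprn_gt0 ?ltr0n //.
apply: le_trans (_ : ((2 * c) ^ m)%:R <= _); last by rewrite ler_nat expn_le_fact.
rewrite expnMn natrM mulrC -!natrX ler_wpM2l // natrX.
by rewrite lerXn2r ?nnegrE.
Qed.

(** Common to sine and cosine. A rational partial sum is evaluated at a rational approximation of
    [x]; the Lipschitz bound pays for moving the argument and the geometric tail for cutting the
    series. *)
Lemma creal_series {E} {HE : env E} (u : R -> nat -> R) (f : R -> R) (x : E -> R) :
  (forall q : nat * E -> R, recq q ->
     recq (fun p : nat * (nat * E) => u (q p.2) p.1)) ->
  (forall x c k, `|x| <= c%:R -> `|u x k| <= ((2 * c) ^ (2 * c))%:R * half ^+ k) ->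
  (forall x, series (u x) @ \oo --> f x) ->
  (forall x y, `|f x - f y| <= `|x - y|) ->
  creal x -> creal (fun e => f (x e)).
Proof.
move=> ru ub uf flip cx; have [b rb xb] := creal_bound cx.
move: cx => [q [rq qx]].
pose q1 (p : nat * E) := q (p.1.+1, p.2).
have rq1 : recq q1 by apply: recq_comp rq _; rec_tac.
(* One more than the bound of [x], so that it also bounds the rational approximation. The series is
   cut at [N.+1] plus [2 * K] with [K = (2 * c) ^ (2 * c)], which absorbs the factor [2 * K] of
   [series_tail]. *)
pose c (e : E) := (b e).+1.
pose n (p : nat * E) := (p.1.+1 + 2 * (2 * c p.2) ^ (2 * c p.2))%N.
have rn : rec n by rewrite /n /c; rec_tac.
exists (fun p => \sum_(i < n p) u (q1 p) (nat_of_ord i)); split.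
  by apply: (recq_sum (q := fun p => u (q1 p.2) p.1)) => //; exact: ru.
move=> N e; set m := n (N, e); set y := q1 (N, e).
have yx : `|y - x e| <= half ^+ N.+1 by exact: qx.
have yc : `|y| <= (c e)%:R.
  rewrite -[y](subrK (x e)) (le_trans (ler_normD _ _)) // addrC /c -addn1 natrD lerD //.
  by rewrite (le_trans yx) // half_le1.
rewrite halfS mulr_natl mulr2n.
rewrite (le_trans (ler_distD (f y) _ _)) // lerD //; last first.
  by rewrite (le_trans (flip _ _)).
have := series_tail m (ub _ _ ^~ yc) (uf y).
rewrite /series /= big_mkord => /le_trans; apply.
by rewrite -natrM natr_half_le.
Qed.

Lemma creal_cos {E} {HE : env E} (x : E -> R) : creal x -> creal (fun e => cos (x e)).
Proof.
apply: (creal_series (u := @cos_coeff' R)).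
- move=> q rq; apply: recq_mul; last first.
    by apply: recq_invn => [|e]; [rec_tac|exact: fact_gt0].
  apply: recq_mul; first by apply: (@recq_sign R _ _ fst); rec_tac.
  by apply: recq_pow; [apply: recq_comp rq _|]; rec_tac.
- move=> x0 c k xc; rewrite /cos_coeff' -mulrA normrM normrX normrN1 expr1n mul1r.
  apply: le_trans (expr_fact_le _ xc) _; rewrite ler_wpM2l // half_decr //.
  by rewrite -addnn leq_addr.
- exact: cvg_cos_coeff'.
- exact: cos_lipschitz.
Qed.

Lemma creal_sin {E} {HE : env E} (x : E -> R) : creal x -> creal (fun e => sin (x e)).
Proof.
apply: (creal_series (u := @sin_coeff' R)).
- move=> q rq; apply: recq_mul; last first.
    by apply: recq_invn => [|e]; [rec_tac|exact: fact_gt0].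
  apply: recq_mul; first by apply: (@recq_sign R _ _ fst); rec_tac.
  by apply: recq_pow; [apply: recq_comp rq _|]; rec_tac.
- move=> x0 c k xc; rewrite /sin_coeff' -mulrA normrM normrX normrN1 expr1n mul1r.
  apply: le_trans (expr_fact_le _ xc) _; rewrite ler_wpM2l // half_decr //.
  by rewrite -addnn -addnS leq_addr.
- exact: cvg_sin_coeff'.
- exact: sin_lipschitz.
Qed.

End Trigonometry.

(** * Computable sequences and integrals *)

Section Bridge.
Variable R : realType.

Lemma ratr_signed_frac (s a b : nat) :
  ratr ((-1) ^+ s * a%:R / b%:R) = (-1) ^+ s * a%:R / b%:R :> R.
Proof. by rewrite !rmorphM /= fmorphV rmorphXn /= rmorphN1 !rmorph_nat. Qed.

Lemma computable_realsP {E} {HE : env E} (x : (arity E).-tuple nat -> R) :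
  computable_reals x <-> creal (fun e : E => x (flat e)).
Proof.
have consE n (v : (arity E).-tuple nat) : [tuple of n :: v] = cons_tuple n v.
  exact: val_inj.
split=> [[r [k [[s [a [b [rs ra rb rE]]]] rk kP]]]|[q [[a [b [d [ra rb rd qE]]]] qx]]].
  pose flatS (p : nat * E) := cons_tuple p.1 (@flat E HE p.2).
  have rflat (f : (arity E).+1.-tuple nat -> nat) :
      recursive f -> rec (fun p : nat * E => f (flatS p)).
    by move=> rf; apply/rec_natP; exists f; split=> // -[n e]; rewrite flat_cons.
  have rt : rec (fun p : nat * E => (k (flatS p), p.2)).
    by apply: rec_pair; [exact: rflat|rec_tac].
  pose q (p : nat * E) : R :=
    (-1) ^+ s (flatS p) * (a (flatS p))%:R / (b (flatS p))%:R.
  have rq : recq q.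
    apply: recq_mul; last first.
      apply: recq_invn => [|e]; first exact: rflat.
      by rewrite lt0n; apply/eqP; case: (rE (flatS e)).
    by apply: recq_mul; [apply: recq_sign|apply: recq_nat]; exact: rflat.
  exists (fun p => q (k (flatS p), p.2)); split; first exact: recq_comp rq rt.
  move=> N e; have := kP (flat e) N _ (leqnn _).
  rewrite !consE; have [_ ->] := rE (cons_tuple (k (cons_tuple N (flat e))) (flat e)).
  by rewrite ratr_signed_frac.
(* [s] is 1 exactly when [a < b], and [c] is [|a - b|], since one of the two truncated differences
   vanishes. The modulus is the identity, read off by [thead]. *)
have [s [rs sE]] := (rec_natP _).1 (recb_leq (rec_succ ra) rb).
have [c [rc cE]] := (rec_natP _).1 (rec_add (rec_sub ra rb) (rec_sub rb ra)).
have [d' [rd' dE]] := (rec_natP _).1 rd.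
exists (fun t => (-1) ^+ s t * (c t)%:R / (d' t)%:R), (fun t => thead t).
split.
- exists s, c, d'; split=> // t; split=> //.
  case/tupleP: t => n v; have [e <-] := flat_surj v.
  by rewrite consE -flat_cons -dE; have [/lt0n_neq0/eqP] := qE (n, e).
- exact: recursive_proj.
- move=> v N k; rewrite theadE => Nk; have [e <-] := flat_surj v.
  rewrite consE -flat_cons -dE -cE -sE.
  rewrite ratr_signed_frac.
  apply: le_trans (half_decr R Nk); have := qx k e.
  have [_ ->] := qE (k, e); congr (`|_ / _ - _| <= _).
  rewrite natr_sub_split; case: ltnP => ab.
    by rewrite (eqP (ltnW ab)) expr1 mulN1r sub0r.
  by rewrite (eqP ab) expr0 mul1r subr0 addn0.
Qed.

Lemma computable_reals1P (x : nat -> R) : computable_reals (family1 x) <-> creal x.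
Proof. exact: (@computable_realsP nat _ (family1 x)). Qed.

Lemma computable_reals2P (x : nat -> nat -> R) :
  computable_reals (family2 x) <-> creal (fun p : nat * nat => x p.1 p.2).
Proof. exact: (@computable_realsP (nat * nat) _ (family2 x)). Qed.

Lemma recursive1P (f : nat -> nat) : recursive (family1 f) <-> rec f.
Proof.
split=> [rf|]; first by apply/rec_natP; exists (family1 f).
exact: (@recursive_flat nat _ (family1 f)).
Qed.

Lemma recursive3P (f : nat -> nat -> nat -> nat) :
  recursive (family3 f) <-> rec (fun p : nat * nat * nat => f p.1.1 p.1.2 p.2).
Proof.
split=> [rf|]; first by apply/rec_natP; exists (family3 f).
exact: (@recursive_flat (nat * nat * nat) _ (family3 f)).
Qed.

(** Condition (i) is used for the sequence [t] composed with the decoding, then read at the index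
    [n e] and the code of [e]. *)
Lemma creal_apply {E} {HE : env E} (f : nat -> R -> R) (n : E -> nat) (t : E -> R) :
  coded E -> computable_funs f -> rec n -> creal t -> creal (fun e => f (n e) (t e)).
Proof.
move=> [c [d [rc rd cdK]]] [cf _] rn ct.
have /computable_reals1P/cf/computable_reals2P ctd := creal_comp ct rd.
apply: (creal_ext (creal_comp ctd (rec_pair rn rc))) => e /=.
by rewrite cdK.
Qed.

Lemma creal_integral {E} {HE : env E} (mu : nat -> probability (measurableTypeR R) R)
    (f : E -> R -> R) (alpha : E * nat * nat -> nat) (L : E -> nat) :
  coded E -> computable_measures mu ->
  (forall x : nat -> R, creal x -> creal (fun p : E * nat => f p.1 (x p.2))) ->
  rec alpha ->
  (forall e l k x y, `|x - y| < 2^-1 ^+ alpha (e, l, k) -> `|x| <= l%:R -> `|y| <= l%:R ->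
     `|f e x - f e y| < 2^-1 ^+ k) ->
  rec L -> (forall e x, (L e)%:R <= `|x| -> f e x = 0) ->
  creal (fun p : nat * E => Rintegral (mu p.1) setT (f p.2)).
Proof.
move=> [c [d [rc rd cdK]]] cmu cf ra alphaP rL LP.
have /cmu/computable_reals2P ci : computable_compact_support_funs (fun n => f (d n)).
  split; last first.
    by exists (fun n => L (d n)); split=> [|n x]; [apply/recursive1P; rec_tac|exact: LP].
  split=> [x /computable_reals1P/cf cx|].
    by apply/computable_reals2P; apply: (creal_comp cx (h := fun p => (d p.1, p.2))); rec_tac.
  exists (fun n l k => alpha (d n, l, k)); split; first by apply/recursive3P; rec_tac.
  by move=> n l k x y; exact: alphaP.
have rh : rec (fun p : nat * E => (p.1, c p.2)) by rec_tac.
by apply: (creal_ext (creal_comp ci rh)) => p /=; rewrite cdK.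
Qed.

End Bridge.

(** * Integration of bounded continuous functions *)

Section Expectation.
Variable R : realType.

(** One class that contains the integrands of the proof and is integrable for every probability, so
    that linearity and monotonicity apply without separate integrability proofs. *)
Definition cbounded (f : R -> R) := continuous f /\ exists B, forall x, `|f x| <= B.

Lemma modulus_continuous (f : R -> R) :
  (forall x k, exists2 d, 0 < d & forall y, `|x - y| < d -> `|f x - f y| < 2^-1 ^+ k) ->
  continuous f.
Proof.
move=> fm x; apply/cvgrPdist_lt => e e0.
have [k ke] : exists k, 2^-1 ^+ k < e.
  exists (Num.bound e^-1).
  have := archi_boundP (ltW (_ : 0 < e^-1)); rewrite invr_gt0 => /(_ e0) h.
  rewrite exprVn invf_plt ?posrE ?exprn_gt0 ?ltr0n // (lt_trans h) //.
  by rewrite -natrX ltr_nat ltn_expl.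
have [d d0 fd] := fm x k.
by near=> y; apply: lt_trans ke; apply: fd; near: y; exact: cvgr_dist_lt.
Unshelve. all: by end_near. Qed.

Lemma lipschitz_continuous (f : R -> R) (M : R) :
  (forall x y, `|f x - f y| <= M * `|x - y|) -> continuous f.
Proof.
move=> fl; apply: modulus_continuous => x k.
have M0 : 0 < `|M| + 1 by rewrite ltr_wpDl.
exists (2^-1 ^+ k / (`|M| + 1)); first by rewrite divr_gt0 ?halfX_gt0.
move=> y; rewrite ltr_pdivlMr // mulrC; apply: le_lt_trans.
rewrite (le_trans (fl x y)) // ler_wpM2r // (le_trans (ler_norm _)) // lerDl //.
Qed.

Lemma cbounded_cst (c : R) : cbounded (fun=> c).
Proof. by split; [exact: cst_continuous|exists `|c|]. Qed.

Lemma cbounded_add (f g : R -> R) :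
  cbounded f -> cbounded g -> cbounded (fun x => f x + g x).
Proof.
move=> [cf [B fB]] [cg [C gC]]; split; first by move=> x; apply: cvgD; [exact: cf|exact: cg].
by exists (B + C) => x; rewrite (le_trans (ler_normD _ _)) // lerD.
Qed.

Lemma cbounded_mul (f g : R -> R) :
  cbounded f -> cbounded g -> cbounded (fun x => f x * g x).
Proof.
move=> [cf [B fB]] [cg [C gC]]; split; first by move=> x; apply: cvgM; [exact: cf|exact: cg].
by exists (B * C) => x; rewrite normrM ler_pM.
Qed.

Lemma cbounded_scale (c : R) (f : R -> R) : cbounded f -> cbounded (fun x => c * f x).
Proof. by move=> cf; apply: cbounded_mul => //; exact: cbounded_cst. Qed.

Lemma cbounded_sub (f g : R -> R) :
  cbounded f -> cbounded g -> cbounded (fun x => f x - g x).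
Proof.
move=> cf cg; under eq_fun do rewrite -mulN1r.
by apply: cbounded_add => //; exact: cbounded_scale.
Qed.

Lemma cbounded_abs (f : R -> R) : cbounded f -> cbounded (fun x => `|f x|).
Proof.
move=> [cf [B fB]]; split; first by move=> x; apply: cvg_norm; exact: cf.
by exists B => x; rewrite normr_id.
Qed.

Lemma cbounded_sum (n : nat) (f : nat -> R -> R) :
  (forall i, cbounded (f i)) -> cbounded (fun x => \sum_(i < n) f i x).
Proof.
move=> cf; elim: n => [|n IH].
  by under eq_fun do rewrite big_ord0; exact: cbounded_cst.
by under eq_fun do rewrite big_ord_recr; exact: cbounded_add.
Qed.

Lemma cbounded_comp_scale (f : R -> R) (t : R) :
  cbounded f -> cbounded (fun x => f (t * x)).
Proof.
move=> [cf [B fB]]; split; last by exists B.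
by move=> x; apply: (@continuous_comp _ _ _ ( *%R t) f); [exact: mulrl_continuous|exact: cf].
Qed.

Lemma cbounded_cos : cbounded (@cos R).
Proof. by split; [exact: continuous_cos|exists 1 => x; exact: cos_max]. Qed.

Lemma cbounded_sin : cbounded (@sin R).
Proof. by split; [exact: continuous_sin|exists 1 => x; exact: sin_max]. Qed.

Variable P : probability (measurableTypeR R) R.
Local Notation EP f := (Rintegral P setT f).

Lemma cbounded_integrable (f : R -> R) : cbounded f -> P.-integrable setT (EFin \o f).
Proof.
move=> [cf [B fB]]; apply: measurable_bounded_integrable => //.
- by rewrite (le_lt_trans (probability_le1 P measurableT)) // ltry.
- exact: measurable_realfun.continuous_measurable_fun.
- by exists B; split; [exact: num_real|move=> M BM x _ /=; apply: le_trans (fB x) (ltW BM)].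
Qed.

Lemma EP_cst (c : R) : EP (fun=> c) = c.
Proof. by rewrite Rintegral_cst // [X in fine X](probability_setT P) mulr1. Qed.

Lemma EP_add (f g : R -> R) :
  cbounded f -> cbounded g -> EP (fun x => f x + g x) = EP f + EP g.
Proof. by move=> cf cg; rewrite RintegralD //; exact: cbounded_integrable. Qed.

Lemma EP_sub (f g : R -> R) :
  cbounded f -> cbounded g -> EP (fun x => f x - g x) = EP f - EP g.
Proof. by move=> cf cg; rewrite RintegralB //; exact: cbounded_integrable. Qed.

Lemma EP_scale (c : R) (f : R -> R) : cbounded f -> EP (fun x => c * f x) = c * EP f.
Proof. by move=> cf; rewrite RintegralZl //; exact: cbounded_integrable. Qed.

Lemma EP_sum (n : nat) (f : nat -> R -> R) : (forall i, cbounded (f i)) ->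
  EP (fun x => \sum_(i < n) f i x) = \sum_(i < n) EP (f i).
Proof.
move=> cf; elim: n => [|n IH].
  by under eq_fun do rewrite big_ord0; rewrite big_ord0 EP_cst.
under eq_fun do rewrite big_ord_recr /=.
by rewrite big_ord_recr EP_add ?IH //; exact: cbounded_sum.
Qed.

Lemma EP_le (f g : R -> R) :
  cbounded f -> cbounded g -> (forall x, f x <= g x) -> EP f <= EP g.
Proof. by move=> cf cg fg; apply: le_Rintegral => //; exact: cbounded_integrable. Qed.

Lemma EP_dist_le (f g h : R -> R) : cbounded f -> cbounded g -> cbounded h ->
  (forall x, `|f x - g x| <= h x) -> `|EP f - EP g| <= EP h.
Proof.
move=> cf cg ch fgh; rewrite -EP_sub //; have cfg := cbounded_sub cf cg.
apply: le_trans (EP_le (cbounded_abs cfg) ch fgh).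
by apply: le_normr_Rintegral => //; exact: cbounded_integrable.
Qed.

(** This is [min (max t 0) 1]. Absolute values preserve computability, whereas a case distinction on
    the order of reals is not effective. *)
Definition clamp (t : R) := (`|t| - `|t - 1| + 1) / 2.

Lemma clamp_ge0 t : 0 <= clamp t.
Proof. by rewrite /clamp; case: (ger0P t); case: (ger0P (t - 1)); lra. Qed.

Lemma clamp_le1 t : clamp t <= 1.
Proof. by rewrite /clamp; case: (ger0P t); case: (ger0P (t - 1)); lra. Qed.

Lemma clamp_eq1 t : 1 <= t -> clamp t = 1.
Proof. by rewrite /clamp; case: (ger0P t); case: (ger0P (t - 1)); lra. Qed.

Lemma clamp_eq0 t : t <= 0 -> clamp t = 0.
Proof. by rewrite /clamp; case: (ger0P t); case: (ger0P (t - 1)); lra. Qed.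

Lemma clamp_lipschitz t s : `|clamp t - clamp s| <= `|t - s|.
Proof.
have -> : clamp t - clamp s = ((`|t| - `|s|) - (`|t - 1| - `|s - 1|)) / 2.
  by rewrite /clamp; ring.
rewrite normrM normfV (ger0_norm (ler0n _ 2)) ler_pdivrMr ?ltr0n // mulr_natr mulr2n.
rewrite (le_trans (ler_normB _ _)) // lerD ?ler_dist_dist //.
by rewrite (le_trans (ler_dist_dist _ _)) // (_ : t - 1 - (s - 1) = t - s) //; ring.
Qed.

Definition tent (N : nat) (x : R) := clamp (N.+1%:R - `|x|).

Lemma tent_ge0 N x : 0 <= tent N x. Proof. exact: clamp_ge0. Qed.

Lemma tent_le1 N x : tent N x <= 1. Proof. exact: clamp_le1. Qed.

Lemma tent_eq1 N x : `|x| <= N%:R -> tent N x = 1.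
Proof. by move=> xN; apply: clamp_eq1; rewrite lerBrDl -natr1 lerD2r. Qed.

Lemma tent_eq0 N x : N.+1%:R <= `|x| -> tent N x = 0.
Proof. by move=> xN; apply: clamp_eq0; rewrite subr_le0. Qed.

Lemma tent_lipschitz N x y : `|tent N x - tent N y| <= `|x - y|.
Proof.
rewrite (le_trans (clamp_lipschitz _ _)) //.
have -> : N.+1%:R - `|x| - (N.+1%:R - `|y|) = `|y| - `|x| by ring.
by rewrite (le_trans (ler_dist_dist _ _)) // distrC.
Qed.

Lemma cbounded_tent N : cbounded (tent N).
Proof.
split; first by apply: (@lipschitz_continuous _ 1) => x y; rewrite mul1r tent_lipschitz.
by exists 1 => x; rewrite ger0_norm ?clamp_ge0 ?clamp_le1.
Qed.

(** Dominated convergence: the tents are bounded by 1 and tend pointwise to 1. This existence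
    statement is what makes the search in [measures_tight] terminate. *)
Lemma tent_tight (e : R) : 0 < e -> exists N, 1 - EP (tent N) < e.
Proof.
move=> e0.
have [|||||_ _ h] := @dominated_convergence _ _ R P setT measurableT
  (fun n x => (tent n x)%:E) (fun=> 1%:E) (fun=> 1%:E).
- move=> n; apply/measurable_realfun.measurable_EFinP.
  by have [+ _] := cbounded_tent n; exact: measurable_realfun.continuous_measurable_fun.
- by apply/measurable_realfun.measurable_EFinP; exact: measurable_cst.
- apply: aeW => x _; apply: cvg_near_cst; exists (Num.bound `|x|) => // n /= nx.
  congr EFin; apply: tent_eq1; rewrite (le_trans (ltW (archi_boundP (normr_ge0 x)))) //.
  by rewrite ler_nat.
- exact: cbounded_integrable (cbounded_cst 1).
- by apply: aeW => x n _ /=; rewrite lee_fin ger0_norm ?clamp_ge0 ?clamp_le1.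
have E1 : (\int[P]_(x in setT) 1 = 1)%E.
  by rewrite integral_cst //= mul1e [LHS](probability_setT P).
rewrite {}E1 in h; have /fine_cvgP [_ /cvgrPdist_lt /(_ e e0) [N _ hN]] := h.
by exists N; apply: le_lt_trans (hN N (leqnn _)); exact: ler_norm.
Qed.

End Expectation.

(** * From measures to characteristic functions *)

Section Forward.
Variable R : realType.
Variable mu : nat -> probability (measurableTypeR R) R.
Local Notation EP m f := (Rintegral (mu m) setT f).
Local Notation half := (2^-1 : R).

Lemma creal_nat {E} {HE : env E} (f : E -> nat) : rec f -> creal (fun e => (f e)%:R : R).
Proof. by move=> rf; apply: creal_recq; exact: recq_nat. Qed.

Lemma creal_invn {E} {HE : env E} (f : E -> nat) : rec f -> (forall e, 0 < f e)%N ->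
  creal (fun e => (f e)%:R^-1 : R).
Proof. by move=> rf f0; apply: creal_recq; exact: recq_invn. Qed.

Lemma creal_tent {E} {HE : env E} (N : E -> nat) (x : E -> R) :
  rec N -> creal x -> creal (fun e => tent (N e) (x e)).
Proof.
move=> rN cx; have c1 : creal (fun _ : E => 1 : R) by exact: (creal_nat (rec_cst 1)).
have ct : creal (fun e => (N e).+1%:R - `|x e|).
  apply: creal_sub; last exact: creal_abs.
  by apply: creal_nat; rec_tac.
apply: creal_mul; last exact: (creal_invn (rec_cst 2)).
apply: creal_add => //; apply: creal_sub; first exact: creal_abs.
by apply: creal_abs; exact: creal_sub.
Qed.

Definition tightness_modulus (N : nat * nat -> nat) :=
  rec N /\ forall m K, 1 - EP m (tent (N (m, K))) <= half ^+ K.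

Section MeasuresComputable.
Hypothesis cmu : computable_measures mu.

Lemma measures_tight : exists N, tightness_modulus N.
Proof.
have [|||||q [rq qE]] := @creal_integral R nat _ mu (@tent R) (fun p => p.2) succn coded_nat cmu.
- by move=> x cx; apply: creal_tent; [rec_tac|apply: creal_comp cx _; rec_tac].
- by rec_tac.
- by move=> e l k x y xy _ _; apply: le_lt_trans xy; exact: tent_lipschitz.
- by rec_tac.
- by move=> e x; exact: tent_eq0.
(* A test on rationals with error [2^-(K+2)]. It accepts any [N] whose tail is below [2^-(K+2)], and
   acceptance forces a tail below [2^-(K+1) + 2^-(K+2)], hence below [2^-K]. *)
pose p (u : nat * (nat * nat)) :=
  q (u.2.2.+2, (u.2.1, u.1)) - (1 - half ^+ u.2.2.+1).
have rp : recq p.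
  apply: recq_sub; first by apply: recq_comp rq _; rec_tac.
  apply: recq_sub; first exact: (recq_nat R (rec_cst 1)).
  apply: recq_pow; last by rec_tac.
  exact: (recq_invn R (rec_cst 2)).
have [|N rN NP] := rec_search (recb_gt0 rp).
  move=> [m K]; have [N hN] := tent_tight (mu m) (halfX_gt0 R K.+2).
  exists N; rewrite /p /= subr_gt0; have := qE K.+2 (m, N); rewrite /= ler_distlC => /andP[_ +].
  have := halfS R K.+1; lra.
exists N; split=> // m K; have [+ _] := NP (m, K); rewrite /p /= subr_gt0.
have := qE K.+2 (m, N (m, K)); rewrite /= ler_distlC => /andP[+ _].
by have := halfS R K.+1; have := halfS R K; have := halfX_gt0 R K.+2; lra.
Qed.

(** Used for [h = cos] and [h = sin], that is for the real and imaginary parts of [phi]. *)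
Lemma char_computable (h : R -> R) :
  (forall x, `|h x| <= 1) -> (forall x y, `|h x - h y| <= `|x - y|) ->
  (forall E (HE : env E) (x : E -> R), creal x -> creal (fun e => h (x e))) ->
  computable_funs (fun m t => EP m (fun x => h (t * x))).
Proof.
move=> h1 hlip hc; have [N [rN NP]] := measures_tight.
have ch t : cbounded (fun x => h (t * x)).
  apply: cbounded_comp_scale; split; last by exists 1.
  by apply: (@lipschitz_continuous _ _ 1) => x y; rewrite mul1r.
have ct (n : nat) := cbounded_tent R n.
have c1t n : cbounded (fun x : R => 1 - tent n x).
  by apply: cbounded_sub => //; exact: cbounded_cst.
have NE m K : EP m (fun x => 1 - tent (N (m, K)) x) <= half ^+ K.
  by rewrite EP_sub ?EP_cst //; exact: cbounded_cst.
split=> [t /computable_reals1P ct_|].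
  apply/computable_reals2P; have [b rb tb] := creal_bound ct_.
  pose f (e : nat * nat) x := tent e.1 x * h (t e.2 * x).
  have cf : creal (fun p : nat * (nat * nat) => EP p.1 (f p.2)).
    (* The integrand has Lipschitz constant [b + 1]: 1 from the tent and [|t j| <= b] from [h]. *)
    apply: (creal_integral (alpha := fun p => (p.2 + (b p.1.1.2).+1)%N)
      (L := fun e => e.1.+1) (coded_prod coded_nat coded_nat) cmu).
    - move=> x cx; have cx2 : creal (fun p : nat * nat * nat => x p.2).
        by apply: creal_comp cx _; rec_tac.
      apply: creal_mul; first by apply: creal_tent => //; rec_tac.
      by apply/hc/creal_mul => //; apply: creal_comp ct_ _; rec_tac.
    - by rec_tac.
    - move=> e l k x y /= xy _ _; rewrite /f.
      apply: lt_le_trans (natr_half_le R (b e.2).+1 k).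
      apply: le_lt_trans (_ : (b e.2).+1%:R * `|x - y| < _); last first.
        by rewrite ltr_pM2l ?ltr0n.
      have -> : tent e.1 x * h (t e.2 * x) - tent e.1 y * h (t e.2 * y) =
        (tent e.1 x - tent e.1 y) * h (t e.2 * x) +
        tent e.1 y * (h (t e.2 * x) - h (t e.2 * y)) by ring.
      rewrite (le_trans (ler_normD _ _)) // -nat1r [leRHS]mulrDl 2!normrM lerD //.
        by rewrite mul1r (le_trans (ler_piMr _ (h1 _))) // tent_lipschitz.
      rewrite (ger0_norm (tent_ge0 _ _)) (le_trans (ler_piMl _ (tent_le1 _ _))) //.
      apply: le_trans (hlip _ _) _.
      by rewrite -mulrBr normrM ler_wpM2r.
    - by rec_tac.
    - by move=> e x /tent_eq0 tx; rewrite /f tx mul0r.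
  apply: (creal_lim (x := fun u : nat * (nat * nat) =>
    EP u.2.1 (f (N (u.2.1, u.1), u.2.2)))).
    by apply: (creal_comp cf (h := fun u => (u.2.1, (N (u.2.1, u.1), u.2.2)))); rec_tac.
  move=> K [m j] /=; apply: le_trans (NE m K).
  apply: EP_dist_le => //; first exact: cbounded_mul.
  move=> x; rewrite /f /=; set c := tent _ _; set d := h _.
  have -> : c * d - d = - ((1 - c) * d) by ring.
  have c1 : 0 <= 1 - c by rewrite subr_ge0 tent_le1.
  by rewrite normrN normrM (ger0_norm c1) ler_piMr // h1.
(* Up to radius [n.+1] the integrands differ by at most [n.+1 * |x - y| < 2^-(k+1)]; beyond it they
   differ by at most 2 on a mass of at most [2^-(k+3)]. *)
exists (fun m l k => ((k.+1) + (N (m, k.+3)).+1)%N); split.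
  by apply/recursive3P; rec_tac.
move=> m l k x y xy _ _; set n := N (m, k.+3) in xy.
have dist : `|EP m (fun z => h (x * z)) - EP m (fun z => h (y * z))| <=
    EP m (fun z => n.+1%:R * `|x - y| + 2 * (1 - tent n z)).
  apply: EP_dist_le => //.
    by apply: cbounded_add; [exact: cbounded_cst|exact: cbounded_scale].
  move=> z; have [zn|zn] := leP `|z| n.+1%:R.
    rewrite (le_trans (hlip _ _)) // -mulrBl normrM mulrC ler_wpDr //.
      by rewrite mulr_ge0 // subr_ge0 tent_le1.
    by rewrite ler_wpM2r.
  rewrite (tent_eq0 (ltW zn)) subr0 ler_wpDl ?mulr_ge0 //.
  by rewrite (le_trans (ler_normB _ _)) // mulr1 -[2]/(1 + 1) lerD.
apply: le_lt_trans dist _; rewrite EP_add ?EP_cst ?EP_scale //; first last.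
- exact: cbounded_scale.
- exact: cbounded_cst.
have := NE m k.+3; rewrite -/n => ltail.
have lhead : n.+1%:R * `|x - y| < half ^+ k.+1.
  apply: lt_le_trans (natr_half_le R n.+1 k.+1).
  by rewrite ltr_pM2l ?ltr0n.
have := halfS R k; have := halfS R k.+1; have := halfS R k.+2; have := halfX_gt0 R k.+3; lra.
Qed.

End MeasuresComputable.
End Forward.

(** * Tail bounds and Bernstein approximation *)

Section Approximation.
Variable R : realType.
Local Notation half := (2^-1 : R).

(** Telescoping: [2 sin (u / 2) cos ((j + 1/2) u)] equals [sin ((j + 1) u) - sin (j u)]. Midpoints
    leave no boundary term. *)
Lemma sum_cos_mul_sin (u : R) (J : nat) :
  2 * sin (u / 2) * (\sum_(j < J) cos ((j%:R + half) * u)) = sin (J%:R * u).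
Proof.
elim: J => [|J IH]; first by rewrite big_ord0 mulr0 mul0r sin0.
rewrite big_ord_recr /= mulrDr IH.
have -> : J%:R * u = (J%:R + half) * u - u / 2 by field.
have -> : J.+1%:R * u = (J%:R + half) * u + u / 2 by rewrite -natr1; field.
by rewrite sinB sinD; ring.
Qed.

Lemma sin_ge_half (v : R) : 0 <= v <= half -> v / 2 <= sin v.
Proof.
move=> /andP[v0 v1]; have := sin_sub_id_le v; rewrite ler_distl => /andP[+ _].
by have : v ^+ 2 <= v / 2; [rewrite expr2 ler_wpM2l|lra].
Qed.

(* The average over the midpoints [t = (j + 1/2) d / J] of [1 - cos (t x)],
   a discrete form of [1 - sin (d x) / (d x)]. *)
Definition cos_defect (d : R) (J : nat) (x : R) :=
  J%:R^-1 * \sum_(j < J) (1 - cos ((j%:R + half) * d / J%:R * x)).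

Lemma cos_defect_ge0 d J x : 0 <= cos_defect d J x.
Proof.
rewrite mulr_ge0 ?invr_ge0 ?ler0n //; apply: sumr_ge0 => j _.
by rewrite subr_ge0 cos_le1.
Qed.

(** For [u = d |x| / J <= 1] the closed form bounds the sum of cosines by [2 / u] when it is
    positive, so their mean is at most [2 / (d |x|) <= 1/2]. The condition [d |x| <= J] brings
    [u / 2] into the range of [sin_ge_half]. *)
Lemma cos_defect_ge (d : R) (J : nat) (x : R) : 0 < d -> (0 < J)%N ->
  4 <= d * `|x| -> d * `|x| <= J%:R -> 2^-1 <= cos_defect d J x.
Proof.
move=> d0 J0 x4 xJ; have J0' : 0 < J%:R :> R by rewrite ltr0n.
have -> : cos_defect d J x = cos_defect d J `|x|.
  congr (_ * _); apply: eq_bigr => j _; congr (1 - _).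
  rewrite -cos_norm -[RHS]cos_norm; congr cos.
  by rewrite [LHS]normrM [RHS]normrM normr_id.
move: `|x| x4 xJ => {x} x x4 xJ.
pose u := d * x / J%:R.
have u0 : 0 < u by rewrite divr_gt0 //; lra.
have u1 : u <= 1 by rewrite ler_pdivrMr // mul1r.
have sge : u / 4 <= sin (u / 2).
  by have -> : u / 4 = u / 2 / 2 by [field]; apply: sin_ge_half; lra.
rewrite /cos_defect sumrB sumr_const card_ord.
have -> : \sum_(i < J) cos ((i%:R + half) * d / J%:R * x) =
          \sum_(i < J) cos ((i%:R + half) * u).
  by apply: eq_bigr => i _; congr cos; rewrite /u; field; rewrite lt0r_neq0.
set S := \sum_(_ < _) _.
have SE : 2 * sin (u / 2) * S <= 1 by rewrite sum_cos_mul_sin sin_le1.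
have Sle : S <= J%:R / 2.
  case: (leP S 0) => [|S0]; first by move/le_trans; apply; rewrite divr_ge0 ?ler0n.
  have : u * S <= 2 by have := ler_wpM2r (ltW S0) sge; lra.
  rewrite /u mulrAC ler_pdivrMr // => h.
  have : 4 * S <= d * x * S by rewrite ler_wpM2r // ltW.
  lra.
rewrite mulrBr mulVf ?lt0r_neq0 // lerBrDl -lerBrDr.
by rewrite mulrC ler_pdivrMr //; lra.
Qed.

(** The discrete defect is periodic in [x], so it detects only the points between [N] and an outer
    radius; the tent of radius [M] takes care of the rest. As [d <= 1], [M.+1] sample points are
    enough up to that radius. *)
Lemma tent_tail_le (d : R) (N M : nat) (x : R) : 0 < d <= 1 -> 4 <= d * N%:R ->
  1 - tent N x <= 2 * cos_defect d M.+1 x + (1 - tent M x).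
Proof.
move=> /andP[d0 d1] dN; have D0 := cos_defect_ge0 d M.+1 x.
have tN := tent_ge0 N x; have tM := tent_le1 M x.
have [xN|xN] := leP `|x| N%:R; first by rewrite (tent_eq1 xN); lra.
have [xM|xM] := leP M.+1%:R `|x|; first by rewrite (tent_eq0 xM); lra.
suff : 2^-1 <= cos_defect d M.+1 x by lra.
apply: cos_defect_ge => //.
  by rewrite (le_trans dN) // ler_wpM2l ?(ltW d0) // ltW.
by rewrite (le_trans _ (ltW xM)) // ler_piMl.
Qed.

Lemma cbounded_cos_scale (t : R) : cbounded (fun x => cos (t * x)).
Proof. exact/cbounded_comp_scale/cbounded_cos. Qed.

(** The outer radius [M] comes from [tent_tight] with an arbitrary tolerance. It affects only the
    number of sample points, all in [[0, d)], and so disappears from the bound. *)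
Lemma tail_le_of_cos (P : probability (measurableTypeR R) R) (d e : R) (N : nat) :
  0 < d <= 1 -> 4 <= d * N%:R ->
  (forall t, 0 <= t < d -> 1 - e <= Rintegral P setT (fun x => cos (t * x))) ->
  1 - Rintegral P setT (tent N) <= 2 * e.
Proof.
move=> d01 dN cose; apply/ler_addgt0Pr => z z0.
have [M hM] := tent_tight P z0.
have c1 : cbounded (fun _ : R => 1) by exact: cbounded_cst.
have c1t n : cbounded (fun x : R => 1 - tent n x).
  by apply: cbounded_sub => //; exact: cbounded_tent.
have c1c t : cbounded (fun x : R => 1 - cos (t * x)).
  by apply: cbounded_sub => //; exact: cbounded_cos_scale.
have cS : cbounded (fun x => \sum_(j < M.+1) (1 - cos ((j%:R + half) * d / M.+1%:R * x))).
  by apply: (@cbounded_sum R M.+1 (fun j x => 1 - cos ((j%:R + half) * d / M.+1%:R * x))).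
have cD : cbounded (cos_defect d M.+1) by exact: cbounded_scale.
have := @EP_le R P _ _ (c1t N) (cbounded_add (cbounded_scale 2 cD) (c1t M))
  (fun x => tent_tail_le M x d01 dN).
rewrite [X in _ <= X -> _]EP_add //; last exact: (cbounded_scale 2 cD).
rewrite EP_scale // !EP_sub ?EP_cst //; try exact: cbounded_tent.
move=> /le_trans; apply; rewrite lerD ?(ltW hM) // ler_wpM2l ?ler0n //.
rewrite EP_scale // (@EP_sum R P M.+1 (fun j x => 1 - cos ((j%:R + half) * d / M.+1%:R * x))) //.
rewrite mulrC ler_pdivrMr ?ltr0n //.
have -> : e * M.+1%:R = \sum_(j < M.+1) e by rewrite sumr_const card_ord mulr_natr.
apply: ler_sum => j _; rewrite EP_sub ?EP_cst //; last exact: cbounded_cos_scale.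
rewrite lerBlDl -lerBlDr; apply: cose; case/andP: d01 => d0 _.
have M0 : 0 < M.+1%:R :> R by rewrite ltr0n.
rewrite divr_ge0 ?mulr_ge0 ?(ltW d0) ?addr_ge0 ?ler0n ?invr_ge0 ?ler0n //=.
rewrite ltr_pdivrMr // mulrC ltr_pM2l //.
have : j.+1%:R <= M.+1%:R :> R by rewrite ler_nat ltn_ord.
rewrite -(natr1 j); have : half < 1 by rewrite invf_lt1 ?ltr1n.
lra.
Qed.

(** Pascal's rule under the sum; it drives both the recursion of Bernstein sums and the expansion of
    powers of sine. *)
Lemma pascal_sum (n : nat) (G : nat -> R) :
  \sum_(j < n.+2) 'C(n.+1, j)%:R * G j = \sum_(j < n.+1) 'C(n, j)%:R * (G j + G j.+1).
Proof.
rewrite big_ord_recl /= bin0 mul1r.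
under eq_bigr do rewrite binS natrD mulrDl.
rewrite big_split /= addrA.
have -> : G 0%N + \sum_(i < n.+1) 'C(n, i.+1)%:R * G i.+1 = \sum_(i < n.+1) 'C(n, i)%:R * G i.
  rewrite [RHS]big_ord_recl /= bin0 mul1r; congr (_ + _).
  by rewrite big_ord_recr /= bin_small // mul0r addr0.
by rewrite -big_split; apply: eq_bigr => i _; rewrite mulrDr.
Qed.

(** The expectation of [v] at a binomial variable of parameters [J] and [y]. The values [v] are not
    tied to nodes [j / J], so that [J] can change in an induction. *)
Definition bern (J : nat) (y : R) (v : nat -> R) :=
  \sum_(j < J.+1) 'C(J, j)%:R * (y ^+ j * (1 - y) ^+ (J - j) * v j).

(** Conditioning on the outcome of one of the [J.+1] trials. *)
Lemma bernS J y v :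
  bern J.+1 y v = (1 - y) * bern J y v + y * bern J y (fun j => v j.+1).
Proof.
rewrite /bern (pascal_sum _ (fun j => y ^+ j * (1 - y) ^+ (J.+1 - j) * v j)).
rewrite !mulr_sumr -big_split; apply: eq_bigr => -[j /= jJ] _.
by rewrite subSS subSn // !exprS; ring.
Qed.

Lemma bern0 y v : bern 0 y v = v 0%N.
Proof. by rewrite /bern big_ord_recl big_ord0 /= bin0 !expr0 !mul1r addr0. Qed.

Lemma bern_cst J y c : bern J y (fun=> c) = c.
Proof. by elim: J => [|J IH]; [rewrite bern0|rewrite bernS IH; ring]. Qed.

(** Variance plus squared bias. The centre [c] is arbitrary because the shift in [bernS] replaces it
    by [c - 1]. *)
Lemma bern_variance J y c :
  bern J y (fun j => (j%:R - c) ^+ 2) = J%:R * (y * (1 - y)) + (J%:R * y - c) ^+ 2.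
Proof.
elim: J c => [|J IH] c; first by rewrite bern0; ring.
rewrite bernS IH; have -> : (fun j => (j.+1%:R - c) ^+ 2) = (fun j => (j%:R - (c - 1)) ^+ 2).
  by apply/funext => j; rewrite -natr1; congr (_ ^+ 2); ring.
by rewrite IH -natr1; ring.
Qed.

(** Chebyshev's argument: the weights are nonnegative with sum 1, and the variance is at most
    [J]. *)
Lemma bern_dist_le J y v c e C : 0 <= y <= 1 -> 0 <= C ->
  (forall j, `|v j - c| <= e + C * (j%:R - J%:R * y) ^+ 2) ->
  `|bern J y v - c| <= e + C * J%:R.
Proof.
move=> /andP[y0 y1] C0 vc; rewrite -{1}(bern_cst J y c).
apply: (@le_trans _ _ (bern J y (fun j => e + C * (j%:R - J%:R * y) ^+ 2))).
  rewrite /bern -sumrB (le_trans (ler_norm_sum _ _ _)) //; apply: ler_sum => j _.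
  have w0 : 0 <= y ^+ j * (1 - y) ^+ (J - j) by rewrite mulr_ge0 ?exprn_ge0 ?subr_ge0.
  rewrite -!mulrBr normrM ger0_norm ?ler0n // ler_wpM2l ?ler0n //.
  by rewrite normrM (ger0_norm w0) ler_wpM2l.
have -> : bern J y (fun j => e + C * (j%:R - J%:R * y) ^+ 2) =
    bern J y (fun=> e) + C * bern J y (fun j => (j%:R - J%:R * y) ^+ 2).
  by rewrite /bern mulr_sumr -big_split; apply: eq_bigr => j _ /=; ring.
rewrite bern_cst bern_variance lerD2l subrr expr0n /= addr0 ler_wpM2l //.
by rewrite ler_piMr ?ler0n // mulr_ile1 ?subr_ge0 // lerBlDr lerDl.
Qed.

(* The Bernstein polynomial of [s |-> f (Q s)] on [-1, 1] taken at
   [s = sin (x / Q)], which is close to [x / Q] when [Q] is large. *)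
Definition sin_bern (f : R -> R) (Q : R) (J : nat) (x : R) :=
  bern J ((1 + sin (Q^-1 * x)) / 2) (fun j => f (Q * (2 * j%:R / J%:R - 1))).

(** One [e] pays for the nearby Bernstein nodes and one for replacing [x] by [Q sin (x / Q)]; the
    quotient pays for the distant nodes. Beyond radius [N.+1] only the trivial bound [2 * B]
    remains. *)
Lemma sin_bern_dist (f : R -> R) (B d e Q : R) (J N : nat) (x : R) :
  (forall x, `|f x| <= B) -> 0 < d -> 0 <= e ->
  (forall x y, `|x - y| < d -> `|f x - f y| <= e) ->
  (0 < J)%N -> 0 < Q -> N.+1%:R ^+ 2 < d * Q ->
  `|sin_bern f Q J x - f x| <=
    2 * e + 8 * B * Q ^+ 2 / (J%:R * d ^+ 2) + 2 * B * (1 - tent N x).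
Proof.
move=> fB d0 e0 fd J0 Q0 NQ; have J0' : 0 < J%:R :> R by rewrite ltr0n.
have B0 : 0 <= B by apply: le_trans (fB 0).
set y := (1 + sin (Q^-1 * x)) / 2.
have y01 : 0 <= y <= 1.
  by rewrite /y; have := sin_le1 (Q^-1 * x); have := sin_geN1 (Q^-1 * x); lra.
have T0 : 0 <= 8 * B * Q ^+ 2 / (J%:R * d ^+ 2).
  by rewrite divr_ge0 ?mulr_ge0 ?exprn_ge0 // ltW.
have [xN|xN] := leP N.+1%:R `|x|.
  rewrite (tent_eq0 xN) subr0 mulr1 (le_trans (ler_normB _ _)) //.
  suff : `|sin_bern f Q J x| <= B by have := fB x; lra.
  rewrite -[sin_bern _ _ _ _]subr0 (le_trans (@bern_dist_le _ _ _ _ B 0 y01 _ _)) //.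
    by move=> j; rewrite subr0 mul0r addr0.
  by rewrite mul0r addr0.
(* The two arguments differ by at most [x ^ 2 / Q], which the choice of [Q] keeps below [d]. *)
have fsin : `|f (Q * sin (Q^-1 * x)) - f x| <= e.
  apply: fd; have -> : Q * sin (Q^-1 * x) - x = Q * (sin (Q^-1 * x) - Q^-1 * x).
    by rewrite mulrBr mulVKf // lt0r_neq0.
  rewrite normrM gtr0_norm // (le_lt_trans (ler_wpM2l (ltW Q0) (sin_sub_id_le _))) //.
  have -> : Q * (Q^-1 * x) ^+ 2 = x ^+ 2 / Q by field; rewrite lt0r_neq0.
  rewrite ltr_pdivrMr //; apply: lt_trans NQ.
  by rewrite -real_normK ?num_real // ltr_pXn2r ?nnegrE.
(* A node at distance at least [d] satisfies [(2 Q / (J d)) ^ 2 (j - J y) ^ 2 >= 1], so there the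
   trivial bound [2 * B] is absorbed by the quadratic term. *)
have bsin : `|sin_bern f Q J x - f (Q * sin (Q^-1 * x))| <=
    e + 2 * B * (2 * Q / (J%:R * d)) ^+ 2 * J%:R.
  have C0 : 0 <= 2 * B * (2 * Q / (J%:R * d)) ^+ 2.
    by apply: mulr_ge0; [apply: mulr_ge0|apply: sqr_ge0].
  apply: bern_dist_le => //.
  move=> j; set s := Q * sin _; set t := Q * _.
  have ts : t - s = 2 * Q / (J%:R * d) * (j%:R - J%:R * y) * d.
    by rewrite /t /s /y; field; rewrite !lt0r_neq0.
  have [tsd|tsd] := ltP `|t - s| d.
    apply: le_trans (fd _ _ tsd) _; rewrite lerDl.
    by apply: mulr_ge0 => //; exact: sqr_ge0.
  rewrite (le_trans (ler_normB _ _)) //.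
  have ge1 : 1 <= (2 * Q / (J%:R * d)) ^+ 2 * (j%:R - J%:R * y) ^+ 2.
    rewrite -exprMn -real_normK ?num_real // exprn_ege1 //.
    by move: tsd; rewrite ts normrM (gtr0_norm d0) ler_pMl.
  have := ler_wpM2l (mulr_ge0 (ler0n R 2) B0) ge1; rewrite mulr1 mulrA.
  by rewrite -/y; have := fB t; have := fB s; lra.
have -> : 8 * B * Q ^+ 2 / (J%:R * d ^+ 2) = 2 * B * (2 * Q / (J%:R * d)) ^+ 2 * J%:R.
  by field; rewrite !lt0r_neq0.
have : 0 <= 2 * B * (1 - tent N x) by rewrite !mulr_ge0 // subr_ge0 tent_le1.
have := ler_distD (f (Q * sin (Q^-1 * x))) (sin_bern f Q J x) (f x).
lra.
Qed.

End Approximation.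

(** * From characteristic functions to measures *)

Section Backward.
Variable R : realType.
Variable mu : nat -> probability (measurableTypeR R) R.
Local Notation EP m f := (Rintegral (mu m) setT f).
Local Notation half := (2^-1 : R).

(** The closure properties below are those of computable linear combinations, which is why powers of
    sine have to be linearized. *)
Definition good {E} {HE : env E} (h : E -> R -> R) :=
  (forall e, cbounded (h e)) /\ creal (fun p : nat * E => EP p.1 (h p.2)).

Lemma good_ext {E} {HE : env E} (g h : E -> R -> R) :
  good g -> (forall e x, g e x = h e x) -> good h.
Proof. by move=> gg gh; suff <- : g = h by []; apply/funext => e; apply/funext. Qed.

Lemma good_comp {E E'} {HE : env E} {HE' : env E'} (h : E' -> R -> R) (g : E -> E') :
  good h -> rec g -> good (fun e => h (g e)).
Proof.
move=> [bh ch] rg; split=> [e|]; first exact: bh.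
by apply: (creal_comp ch (h := fun p => (p.1, g p.2))); rec_tac.
Qed.

Lemma good_add {E} {HE : env E} (g h : E -> R -> R) :
  good g -> good h -> good (fun e x => g e x + h e x).
Proof.
move=> [bg cg] [bh ch]; split=> [e|]; first exact: cbounded_add.
by apply: (creal_ext (creal_add cg ch)) => p; rewrite EP_add.
Qed.

Lemma good_scale {E} {HE : env E} (c : E -> R) (h : E -> R -> R) :
  creal c -> good h -> good (fun e x => c e * h e x).
Proof.
move=> cc [bh ch]; split=> [e|]; first exact: cbounded_scale.
have cc2 : creal (fun p : nat * E => c p.2) by apply: creal_comp cc _; rec_tac.
by apply: (creal_ext (creal_mul cc2 ch)) => p; rewrite EP_scale.
Qed.

Lemma good_sum {E} {HE : env E} (n : E -> nat) (h : nat * E -> R -> R) :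
  rec n -> good h -> good (fun e x => \sum_(i < n e) h (nat_of_ord i, e) x).
Proof.
move=> rn [bh ch]; split=> [e|].
  by apply: (@cbounded_sum R (n e) (fun i x => h (i, e) x)).
apply: (@creal_ext R (nat * E) _ (fun p => \sum_(i < n p.2) EP p.1 (h (nat_of_ord i, p.2)))).
  apply: (@creal_sum R (nat * E) _ (fun u => EP u.2.1 (h (u.1, u.2.2))) (fun p => n p.2)).
- by apply: (creal_comp ch (h := fun u => (u.2.1, (u.1, u.2.2)))); rec_tac.
- by rec_tac.
- by move=> [m e]; rewrite (@EP_sum R (mu m) (n e) (fun i x => h (i, e) x)).
Qed.

Hypothesis ccos : computable_funs (fun m t => EP m (fun x => cos (t * x))).
Hypothesis csin : computable_funs (fun m t => EP m (fun x => sin (t * x))).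

Let freq (u : nat * nat * nat) : R := (u.1.1%:R - u.1.2%:R) / u.2.+1%:R.

Let creal_freq : creal (fun p : nat * (nat * nat * nat) => freq p.2).
Proof.
apply: creal_mul; last by apply: creal_invn => //; rec_tac.
by apply: creal_sub; apply: creal_nat; rec_tac.
Qed.

Let coded_freq : coded (nat * (nat * nat * nat)).
Proof. by do !apply: coded_prod; exact: coded_nat. Qed.

Let good_cos : good (fun u x => cos (freq u * x)).
Proof.
split=> [u|]; first exact: cbounded_cos_scale.
by apply: (creal_apply (n := fst) coded_freq ccos _ creal_freq); rec_tac.
Qed.

Let good_sin : good (fun u x => sin (freq u * x)).
Proof.
split=> [u|]; first by apply: cbounded_comp_scale; exact: cbounded_sin.
by apply: (creal_apply (n := fst) coded_freq csin _ creal_freq); rec_tac.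
Qed.

(* This is [cos (t - r pi / 2)]. *)
Let cos_shift (r : nat) (t : R) :=
  (-1) ^+ (r %/ 2) * (~~ odd r)%:R * cos t + (-1) ^+ (r %/ 2) * (odd r)%:R * sin t.

(** The product-to-sum formula with the phase [r pi / 2] encoded by the parity of [r] and a sign, so
    that all coefficients are rational. *)
Lemma cos_shiftS r (s t : R) :
  2 * sin s * cos_shift r t = cos_shift r.+1 (t + s) - cos_shift r.+1 (t - s).
Proof.
rewrite /cos_shift !divn2 /= uphalf_half cosD sinD cosB sinB.
by case: (odd r); rewrite /= ?add0n ?add1n ?exprS ?(mulr0n, mulr1n); ring.
Qed.

(** The real form of the binomial expansion of [(e^(is) - e^(-is)) ^ r], divided by [i ^ r]. *)
Lemma sin_pow_expand r (s : R) :
  2 ^+ r * sin s ^+ r =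
  \sum_(j < r.+1) 'C(r, j)%:R * ((-1) ^+ j * cos_shift r ((r%:R - (2 * j)%N%:R) * s)).
Proof.
elim: r => [|r IH].
  rewrite big_ord_recl big_ord0 /cos_shift /= div0n bin0 subrr mul0r cos0 sin0 !expr0.
  by ring.
rewrite (pascal_sum r (fun j => (-1) ^+ j * cos_shift r.+1 ((r.+1%:R - (2 * j)%N%:R) * s))).
rewrite !exprS mulrACA IH mulr_sumr; apply: eq_bigr => j _.
have -> : 2 * sin s * ('C(r, j)%:R * ((-1) ^+ j * cos_shift r ((r%:R - (2 * j)%N%:R) * s))) =
  'C(r, j)%:R * ((-1) ^+ j * (2 * sin s * cos_shift r ((r%:R - (2 * j)%N%:R) * s))) by ring.
rewrite cos_shiftS exprS.
have -> : (r%:R - (2 * j)%N%:R) * s + s = (r.+1%:R - (2 * j)%N%:R) * s.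
  by rewrite -natr1; ring.
have -> : (r%:R - (2 * j)%N%:R) * s - s = (r.+1%:R - (2 * j.+1)%N%:R) * s.
  by rewrite !natrM -!natr1; ring.
by ring.
Qed.

Lemma good_sin_pow : good (fun (e : nat * nat) x => sin (e.2.+1%:R^-1 * x) ^+ e.1).
Proof.
(* The term [j] of the expansion at [s = x / (q + 1)] has frequency [(r - 2 j) / (q + 1)]. *)
pose fr (u : nat * (nat * nat)) := (u.2.1, (2 * u.1)%N, u.2.2).
have rfr : rec fr by rewrite /fr; rec_tac.
have csg (b : nat * (nat * nat) -> nat) : rec b ->
    creal (fun u : nat * (nat * nat) => (-1) ^+ (u.2.1 %/ 2) * (b u)%:R : R).
  move=> rb; apply: creal_recq; apply: recq_mul; last exact: recq_nat.
  by apply: recq_sign; rec_tac.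
have gshift : good (fun (u : nat * (nat * nat)) x => cos_shift u.2.1 (freq (fr u) * x)).
  apply: good_add; apply: good_scale.
  - by apply: (csg (fun u => ~~ odd u.2.1)); rec_tac.
  - exact: (good_comp good_cos rfr).
  - by apply: (csg (fun u => odd u.2.1)); rec_tac.
  - exact: (good_comp good_sin rfr).
have cbin : creal (fun u : nat * (nat * nat) =>
    half ^+ u.2.1 * ('C(u.2.1, u.1)%:R * (-1) ^+ u.1)).
  apply: creal_recq; apply: recq_mul.
    by apply: recq_pow; [exact: (recq_invn R (rec_cst 2))|rec_tac].
  by apply: recq_mul; [apply: recq_nat|apply: recq_sign]; rec_tac.
apply: (good_ext (good_sum (n := fun e => e.1.+1) _ (good_scale cbin gshift))).
  by rec_tac.
move=> [r q] x /=; set s := _^-1 * x.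
have -> : sin s ^+ r = half ^+ r * (2 ^+ r * sin s ^+ r).
  by rewrite mulrA -exprMn mulVf ?expr1n ?mul1r // pnatr_eq0.
rewrite sin_pow_expand mulr_sumr; apply: eq_bigr => j _.
have -> : freq (fr (nat_of_ord j, (r, q))) * x = (r%:R - (2 * j)%N%:R) * s.
  by rewrite /freq /s /=; ring.
by ring.
Qed.

(** The argument in [[0, 1]] of the Bernstein polynomial in [sin_bern], for [Q = q.+1]. *)
Let wave (q : nat) (x : R) := (1 + sin (q.+1%:R^-1 * x)) / 2.

Lemma good_wave_pow : good (fun (e : nat * nat) x => wave e.2 x ^+ e.1).
Proof.
have cbin : creal (fun u : nat * (nat * nat) => half ^+ u.2.1 * 'C(u.2.1, u.1)%:R).
  apply: creal_recq; apply: recq_mul; last by apply: recq_nat; rec_tac.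
  by apply: recq_pow; [exact: (recq_invn R (rec_cst 2))|rec_tac].
have gs : good (fun (u : nat * (nat * nat)) x => sin (u.2.2.+1%:R^-1 * x) ^+ u.1).
  by apply: (good_comp good_sin_pow (g := fun u => (u.1, u.2.2))); rec_tac.
apply: (good_ext (good_sum (n := fun e => e.1.+1) _ (good_scale cbin gs))).
  by rec_tac.
move=> [r q] x /=; rewrite /wave expr_div_n exprDn mulr_suml; apply: eq_bigr => j _.
by rewrite expr1n mul1r -mulr_natl exprVn; ring.
Qed.

Lemma good_wave_bernstein :
  good (fun (e : nat * nat * nat) x => wave e.2 x ^+ e.1.1 * (1 - wave e.2 x) ^+ e.1.2).
Proof.
have cbin : creal (fun u : nat * (nat * nat * nat) =>
    'C(u.2.1.2, u.1)%:R * (-1) ^+ u.1 : R).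
  by apply: creal_recq; apply: recq_mul; [apply: recq_nat|apply: recq_sign]; rec_tac.
have gs : good (fun (u : nat * (nat * nat * nat)) x => wave u.2.2 x ^+ (u.2.1.1 + u.1)).
  by apply: (good_comp good_wave_pow (g := fun u => ((u.2.1.1 + u.1)%N, u.2.2))); rec_tac.
apply: (good_ext (good_sum (n := fun e => e.1.2.+1) _ (good_scale cbin gs))).
  by rec_tac.
move=> [[j l] q] x /=; rewrite exprBn mulr_sumr; apply: eq_bigr => i _.
by rewrite expr1n mulr1 -mulr_natl exprD; ring.
Qed.

Lemma tight_of_cos : exists N, tightness_modulus mu N.
Proof.
case: ccos => _ [alpha [/recursive3P ra alphaP]].
(* With [d = 2^-a], where [a = alpha m 1 K.+1], the real part of [phi_m] stays above [1 - 2^-(K+1)]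
   on [[0, d)], and the radius [4 * 2 ^ a] gives [d * N = 4]. As [d <= 1], the modulus is taken on
   [[-1, 1]]. *)
exists (fun u => 4 * 2 ^ alpha u.1 1 u.2.+1)%N; split.
  have raK : rec (fun u : nat * nat => alpha u.1 1%N u.2.+1).
    by apply: (rec_comp ra (h := fun u => (u.1, 1%N, u.2.+1))); rec_tac.
  by rec_tac.
move=> m K /=; set a := alpha m 1%N K.+1; rewrite [leRHS]halfS.
apply: (@tail_le_of_cos _ _ (half ^+ a)).
- by rewrite halfX_gt0 half_le1.
- by rewrite natrM natrX exprVn mulrCA mulVf ?mulr1 // expf_neq0 // pnatr_eq0.
- move=> t /andP[t0 ta].
  have := alphaP m 1%N K.+1 t 0; rewrite subr0 normr0 (ger0_norm t0) -/a => /(_ ta).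
  have -> : EP m (fun x => cos (0 * x)) = 1.
    by under eq_fun do rewrite mul0r cos0; exact: EP_cst.
  rewrite (ltW (lt_le_trans ta (half_le1 R a))) ler0n => /(_ isT isT).
  by rewrite ltr_distl => /andP[/ltW].
Qed.

(** Walking inward from the edge of the support in steps of [2^-(a+1)], each of which changes [f] by
    less than 1; [L * 2 ^ a.+1] steps reach the origin. This yields a recursive bound of [f]. *)
Lemma support_bound (f : R -> R) (L a : nat) :
  (forall x, L%:R <= `|x| -> f x = 0) ->
  (forall x y, `|x - y| < half ^+ a -> `|f x - f y| < 1) ->
  forall x, `|f x| <= (L * 2 ^ a.+1)%:R.
Proof.
move=> fL fa x; pose h := half ^+ a.+1; have h0 : 0 < h by exact: halfX_gt0.
have claim i : forall x, L%:R - i%:R * h <= `|x| -> `|f x| <= i%:R.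
  elim: i => [|i IH] {}x; first by rewrite mul0r subr0 => /fL ->; rewrite normr0.
  move=> xi; have [y xy yh] : exists2 y, `|x - y| = h & `|y| = `|x| + h.
    have [x0|x0] := leP 0 x.
      exists (x + h); first by rewrite opprD addNKr normrN gtr0_norm.
      by rewrite (ger0_norm x0) ger0_norm // addr_ge0 // ltW.
    exists (x - h); first by rewrite subKr gtr0_norm.
    have xh : x - h <= 0 by lra.
    by rewrite (ltr0_norm x0) (ler0_norm xh); ring.
  have fy : `|f y| <= i%:R.
    by apply: IH; move: xi; rewrite yh -natr1; lra.
  have fxy : `|f x - f y| < 1.
    by apply: fa; rewrite xy halfS -/h; lra.
  rewrite -natr1 -[f x](subrK (f y)) (le_trans (ler_normD _ _)) // addrC lerD //.
  exact: ltW.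
apply: claim; rewrite natrM natrX /h exprVn mulfK ?expf_neq0 ?pnatr_eq0 //.
by rewrite subrr.
Qed.

Lemma measures_of_char : computable_measures mu.
Proof.
move=> f [cf [L [/recursive1P rL LP]]]; have [N0 [rN0 N0P]] := tight_of_cos.
have [_ [alpha [/recursive3P ralpha alphaP]]] := cf.
(* A modulus valid on the whole line: two points at distance less than 1 lie both within radius
   [L + 1] or both outside the open ball of radius [L], where [f] vanishes. *)
pose a (u : nat * nat) := alpha u.1 (L u.1).+1 u.2.
have ra : rec a.
  by apply: (rec_comp ralpha (h := fun u => (u.1, (L u.1).+1, u.2))); rec_tac.
have fa n k x y : `|x - y| < half ^+ a (n, k) -> `|f n x - f n y| < half ^+ k.
  move=> xy; have xy1 : `|x - y| < 1 by apply: lt_le_trans xy (half_le1 R _).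
  have [xL|xL] := leP `|x| (L n).+1%:R; have [yL|yL] := leP `|y| (L n).+1%:R.
  - exact: (alphaP _ _ _ _ _ xy xL yL).
  - have hx : (L n)%:R <= `|x|.
      by have := ler_normD (y - x) x; rewrite subrK distrC; move: yL; rewrite -natr1; lra.
    by rewrite (LP _ _ hx) (LP _ y) ?subrr ?normr0 ?halfX_gt0 // (le_trans _ (ltW yL)) // ler_nat.
  - have hy : (L n)%:R <= `|y|.
      by have := ler_normD (x - y) y; rewrite subrK; move: xL; rewrite -natr1; lra.
    by rewrite (LP _ _ hy) (LP _ x) ?subrr ?normr0 ?halfX_gt0 // (le_trans _ (ltW xL)) // ler_nat.
  - rewrite (LP _ x) ?(LP _ y) ?subrr ?normr0 ?halfX_gt0 //.
      by rewrite (le_trans _ (ltW yL)) // ler_nat.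
    by rewrite (le_trans _ (ltW xL)) // ler_nat.
(* The successor makes the bound positive, which [J0] and the division in [main] rely on. *)
pose B n := (L n * 2 ^ (a (n, 0)).+1).+1%N.
have rB : rec B by rewrite /B; rec_tac.
have fB n x : `|f n x| <= (B n)%:R.
  apply: le_trans (@support_bound _ _ (a (n, 0%N)) (LP n) _ x) _; last by rewrite ler_nat.
  by move=> {}x y /fa; rewrite expr0.
have bf n : cbounded (f n).
  split; last by exists (B n)%:R.
  apply: modulus_continuous => x k; exists (half ^+ a (n, k)); first exact: halfX_gt0.
  by move=> y; exact: fa.
(* Here [p = (K, (m, n))] and each error is to be at most [2^-(K+2)]. [A] gives the modulus
   [d = 2^-A]; [N] spends [2 * B] extra bits on the tail; [q] makes [d * (q + 1)] exceed
   [(N + 1) ^ 2]; [J] makes the variance term exactly [2^-(K+2)]. *)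
pose A (p : nat * (nat * nat)) := a (p.2.2, p.1.+2).
have rA : rec A by rewrite /A; rec_tac.
pose N (p : nat * (nat * nat)) := N0 (p.2.1, (p.1.+2 + 2 * B p.2.2)%N).
have rN : rec N by rewrite /N; rec_tac.
pose q (p : nat * (nat * nat)) := ((N p).+1 ^ 2 * 2 ^ A p)%N.
have rq : rec q by rewrite /q; rec_tac.
pose J (p : nat * (nat * nat)) :=
  (8 * B p.2.2 * (q p).+1 ^ 2 * (2 ^ A p) ^ 2 * 2 ^ p.1.+2)%N.
have rJ : rec J by rewrite /J; rec_tac.
have J0 p : (0 < J p)%N.
  by rewrite /J 4!muln_gt0 (expn_gt0 _ p.1.+2) (expn_gt0 _ 2) (expn_gt0 (2 ^ A p)) expn_gt0.
pose X p := EP p.2.1 (sin_bern (f p.2.2) (q p).+1%:R (J p)).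
have bw e := good_wave_bernstein.1 e.
(* Linearity leaves a finite sum of binomials, values of [f] at rational nodes and expectations
   covered by [good_wave_bernstein]. *)
have XE p : X p = \sum_(j < (J p).+1) 'C(J p, j)%:R *
    f p.2.2 ((q p).+1%:R * (2 * j%:R / (J p)%:R - 1)) *
    EP p.2.1 (fun x => wave (q p) x ^+ j * (1 - wave (q p) x) ^+ (J p - j)).
  rewrite /X; transitivity (EP p.2.1 (fun x => \sum_(j < (J p).+1) 'C(J p, j)%:R *
    f p.2.2 ((q p).+1%:R * (2 * j%:R / (J p)%:R - 1)) *
    (wave (q p) x ^+ j * (1 - wave (q p) x) ^+ (J p - j)))).
    congr Rintegral; apply/funext => x; apply: eq_bigr => j _; rewrite -/(wave _ _); ring.
  rewrite (@EP_sum R (mu p.2.1) (J p).+1 (fun j x => 'C(J p, j)%:R *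
    f p.2.2 ((q p).+1%:R * (2 * j%:R / (J p)%:R - 1)) *
    (wave (q p) x ^+ j * (1 - wave (q p) x) ^+ (J p - j)))) => [|j].
    by apply: eq_bigr => j _; rewrite EP_scale //; exact: (bw (nat_of_ord j, J p - j, q p)%N).
  by apply: cbounded_scale; exact: (bw (j, J p - j, q p)%N).
have cX : creal X.
  rewrite (funext XE).
  apply: (@creal_sum R _ _ (fun u : nat * (nat * (nat * nat)) => 'C(J u.2, u.1)%:R *
    f u.2.2.2 ((q u.2).+1%:R * (2 * u.1%:R / (J u.2)%:R - 1)) *
    EP u.2.2.1 (fun x => wave (q u.2) x ^+ u.1 * (1 - wave (q u.2) x) ^+ (J u.2 - u.1)))
    (fun p => (J p).+1)); last by rec_tac.
  apply: creal_mul; last first.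
    apply: (creal_comp good_wave_bernstein.2
      (h := fun u => (u.2.2.1, (u.1, (J u.2 - u.1)%N, q u.2)))); rec_tac.
  apply: creal_mul; first by apply: creal_nat; rec_tac.
  apply: (creal_apply (n := fun u => u.2.2.2) _ cf).
  - by do !apply: coded_prod; exact: coded_nat.
  - by rec_tac.
  apply: creal_mul; first by apply: creal_nat; rec_tac.
  apply: creal_sub; last exact: (creal_nat R (rec_cst 1)).
  apply: creal_mul; last by apply: creal_invn => //; rec_tac.
  apply: creal_mul; first exact: (creal_nat R (rec_cst 2)).
  by apply: creal_nat; rec_tac.
apply/computable_reals2P; apply: (creal_lim cX) => K [m n] /=.
set p := (K, (m, n)); rewrite /X /=.
have bs : cbounded (sin_bern (f n) (q p).+1%:R (J p)).
  apply: (@cbounded_sum R _ (fun j x => 'C(J p, j)%:R * (wave (q p) x ^+ j *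
    (1 - wave (q p) x) ^+ (J p - j) * f n ((q p).+1%:R * (2 * j%:R / (J p)%:R - 1))))).
  move=> j; apply: cbounded_scale; apply: cbounded_mul; last exact: cbounded_cst.
  exact: (bw (j, J p - j, q p)%N).
set k := K.+2; set b := (B n)%:R : R; set d := half ^+ A p; set Q := (q p).+1%:R : R.
have d0 : 0 < d by exact: halfX_gt0.
have d2 : (2 ^ A p)%:R * d = 1.
  by rewrite natrX /d exprVn mulfV // expf_neq0 // pnatr_eq0.
have dist x := @sin_bern_dist R (f n) b d (half ^+ k) Q (J p) (N p) x (fB n) d0
  (ltW (halfX_gt0 R k)) (fun x y xy => ltW (fa n k x y xy)) (J0 p).
have Q0 : 0 < Q by rewrite ltr0n.
have NQ : (N p).+1%:R ^+ 2 < d * Q.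
  have -> : (N p).+1%:R ^+ 2 = d * (q p)%:R.
    by rewrite mulrC /q natrM natrX -mulrA d2 mulr1.
  by rewrite ltr_pM2l // ltr_nat ltnSn.
have b0 : 0 < b by rewrite ltr0n.
have main : 8 * b * Q ^+ 2 / ((J p)%:R * d ^+ 2) = half ^+ k.
  have -> : (J p)%:R * d ^+ 2 = 8 * b * Q ^+ 2 * 2 ^+ k * ((2 ^ A p)%:R * d) ^+ 2.
    have JE u v w i :
        (8 * u * v ^ 2 * w ^ 2 * 2 ^ i)%:R = 8 * u%:R * v%:R ^+ 2 * w%:R ^+ 2 * 2 ^+ i :> R.
      by rewrite 4!natrM 3!natrX.
    by rewrite /J JE -/b -/Q -/k exprMn; ring.
  rewrite d2 expr1n mulr1 invfM mulrA mulfV ?mul1r ?exprVn //.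
  by rewrite !mulf_neq0 ?expf_neq0 ?lt0r_neq0.
rewrite main in dist.
have ct := cbounded_tent R (N p).
have c1 : cbounded (fun _ : R => 1 : R) by exact: cbounded_cst.
have c1t := cbounded_sub c1 ct.
have c2t := cbounded_scale (2 * b) c1t.
have cc : cbounded (fun _ : R => 2 * half ^+ k + half ^+ k) by exact: cbounded_cst.
apply: le_trans (EP_dist_le (mu m) bs (bf n) (cbounded_add cc c2t) (fun x => dist x Q0 NQ)) _.
rewrite EP_add // EP_cst EP_scale // EP_sub // EP_cst.
have tail : 2 * b * (1 - EP m (tent (N p))) <= half ^+ k.
  apply: le_trans (natr_half_le R (2 * B n) k); rewrite natrM.
  by apply: ler_wpM2l (N0P m _); rewrite mulr_ge0 // ltW.
(* Four errors of [2^-(K+2)]: two from the modulus of [f], one from the variance, one from the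
   tail. *)
by have := halfS R K; have := halfS R K.+1; rewrite -/k; lra.
Qed.

End Backward.

(** * Real and imaginary parts of the characteristic function, and the equivalence *)

Lemma characteristic_functionE (R : realType) (P : probability (measurableTypeR R) R) (t : R) :
  characteristic_function P t =
  complex.Complex (Rintegral P setT (fun x => cos (t * x)))
                  (Rintegral P setT (fun x => sin (t * x))).
Proof.
have expE x : complex_exp ('i * t%:C * x%:C)%C = complex.Complex (cos (t * x)) (sin (t * x)).
  apply/eqP; rewrite eq_complex /=.
  rewrite !(mul0r, mulr0, mul1r, subr0, sub0r, add0r, addr0, oppr0, expR0).
  by rewrite !eqxx.
by congr complex.Complex; congr Rintegral; apply/funext => x; rewrite expE.
Qed.

Theorem theorem4p6 (R : realType)
    (mu : nat -> probability (measurableTypeR R) R)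
    (phi : nat -> R -> R[i])
    (hphi : forall (m : nat) (t : R), phi m t = characteristic_function (mu m) t) :
  computable_measures mu <-> computable_complex_funs phi.
Proof.
rewrite /computable_complex_funs.
have -> : (fun n x => complex.Re (phi n x)) =
    (fun m t => Rintegral (mu m) setT (fun x => cos (t * x))).
  by apply/funext => m; apply/funext => t; rewrite hphi characteristic_functionE.
have -> : (fun n x => complex.Im (phi n x)) =
    (fun m t => Rintegral (mu m) setT (fun x => sin (t * x))).
  by apply/funext => m; apply/funext => t; rewrite hphi characteristic_functionE.
split=> [cmu|[cc cs]]; last exact: measures_of_char.
split; apply: char_computable => //.
- exact: cos_max.
- exact: cos_lipschitz.
- by move=> E HE x; exact: creal_cos.
- exact: sin_max.
- exact: sin_lipschitz.
- by move=> E HE x; exact: creal_sin.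
Qed.
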